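(* Let $P$ be a network, $N$ a consensus matrix, $\mathcal{O}_{m,L}$ a class of operators, $\mathcal{L}_{\mathrm{info}}\subseteq\mathbb{R}^{n_u\times n_y}$ an information constraint set and $\mathcal{L}^D$ an information structure set derived from $\mathcal{L}_{\mathrm{info}}$, such that Assumptions 1–5 stated in the context hold. Let $(\Pi,\Gamma,\Phi)$ be a solution of the plant regulator equation with associated full-order internal model $\Sigma_{\mathrm{full}}$, let $\rho\in(0,1)$ and let $\nu_{\max}\in\mathbb{N}$ be the filter length. Suppose a subcontroller $\Sigma_{\mathrm f}=(A_f,B_f,(C_f^1;C_f^2),(D_f^1;D_f^2))$ and filter coefficients $\lambda=(\lambda^i_\nu)$ solve the full-order synthesis problem, i.e., with $K:=\Sigma_{\mathrm{full}}\star\Sigma_{\mathrm f}$ and the well-posed interconnection $P\star K$ with matrices $(\mathcal{A},\mathcal{B},\mathcal{C},\mathcal{D})$: 1. $D_f^2\in\mathcal{L}^D$; 2. for the realization $(\hat{\mathcal{A}},\hat{\mathcal{B}},\hat{\mathcal{C}}(\lambda),\hat{\mathcal{D}}(\lambda))$ of the filtered interconnection defined in the context (with $I-\mathbf{m}\mathcal{D}$ invertible), there is a symmetric $\mathcal{M}\succ0$ with $$\begin{pmatrix} \hat{\mathcal{A}} & \hat{\mathcal{B}} \\ I & 0 \end{pmatrix}^\top \begin{pmatrix} \mathcal{M} & 0 \\ 0 & -\mathcal{M} \end{pmatrix} \begin{pmatrix} \hat{\mathcal{A}} & \hat{\mathcal{B}} \\ I & 0 \end{pmatrix} + \frac12 \begin{pmatrix}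 \hat{\mathcal{C}}(\lambda) & \hat{\mathcal{D}}(\lambda) \\ 0 & I \end{pmatrix}^\top \begin{pmatrix} 0 & I \\ I & 0 \end{pmatrix} \begin{pmatrix} \hat{\mathcal{C}}(\lambda) & \hat{\mathcal{D}}(\lambda) \\ 0 & I \end{pmatrix} \prec 0$$ and $\sum_{\nu=0}^{\nu_{\max}}\rho^{-\nu}\lambda^i_\nu>0$, $\lambda^i_\nu\le0$ for all $\nu\ge1$, for all $i\in\{1,\dots,s\}$. Then the controller $K=\Sigma_{\mathrm{full}}\star\Sigma_{\mathrm f}$ leads to an algorithm $F\star(P\star K)$ that is well-posed and $\rho$-exponentially convergent for all $F\in\mathcal{O}_{m,L}$.
   Context: Function classes. Let $\mathbf{q}(x)=\frac12\|x\|^2$ on $\mathbb{R}^c$. For $m\in\mathbb{R}$, $L\in(m,\infty]$, $\mathcal{S}_{m,L}$ is the class of $f:\mathbb{R}^c\to\mathbb{R}\cup\{\pm\infty\}$ such that $f-m\mathbf{q}$ is proper, convex and closed (p.c.c.) and, if $L<\infty$, also $L\mathbf{q}-f$ is p.c.c.; $\partial f:=\partial(f-m\mathbf{q})+mI$ with the convex subdifferential on the right. Fix $s,c\ge1$ and $m=(m_1,\dots,m_s)$, $L=(L_1,\dots,L_s)$ with $m_i\in\mathbb{R}$, $L_i\in(m_i,\infty]$, $\sum_i m_i>0$. $\mathcal{O}_{m,L}$ is the class of operators $F:\mathbb{R}^{sc}\rightrightarrows\mathbb{R}^{sc}$, $F(z)=\partial f_1(z^1)\times\cdots\times\partial f_s(z^s)$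 with $f_i\in\mathcal{S}_{m_i,L_i}$, for which there is a unique pair $(\beta^*,w^* )\in\mathbb{R}^c\times\mathbb{R}^{sc}$ with $\sum_i w_i^*=0$, $w_i^*\in\partial f_i(\beta^* )$ for all $i$. Consensus matrix: $N\in\mathbb{R}^{sc\times(s-1)c}$ with $\mathrm{rank}(N)=(s-1)c$ and $\mathrm{ran}(N)=\mathrm{null}((\mathbf{1}_s\otimes I_c)^\top)$ (empty if $s=1$), where $\mathbf{1}_s$ is the all-ones vector. Interconnection. The network $P$ is $x^N_{k+1}=Ax^N_k+B_1w_k+B_2u_k$, $z_k=C_1x^N_k+D_1w_k+D_{12}u_k$, $y_k=C_2x^N_k+D_{21}w_k+D_2u_k$ with $w_k,z_k\in\mathbb{R}^{sc}$, $u_k\in\mathbb{R}^{n_u}$, $y_k\in\mathbb{R}^{n_y}$; a controller $K$ is $\xi_{k+1}=A_c\xi_k+B_cy_k$, $u_k=C_c\xi_k+D_cy_k$. $P\star K$ is well-posed if $I-D_2D_c$ is invertible; eliminating $(u,y)$ gives $x_{k+1}=\mathcal{A}x_k+\mathcal{B}w_k$, $z_k=\mathcal{C}x_k+\mathcal{D}w_k$ with $x_k=(x^N_k,\xi_k)$, $\mathcal{D}=D_1+D_{12}D_c(I-D_2D_c)^{-1}D_{21}$. The algorithm $F\star(P\star K)$ is this system together with $w_k\in F(z_k)$; it is well-posed if $(F^{-1}-\mathcal{D})^{-1}$ is globally continuous (exactly one value at every point, and continuous), where $F^{-1}(x)=\{y\mid x\in F(y)\}$. It is convergent if there is $(x^*,z^*,w^*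 )$ with $x^*=\mathcal{A}x^*+\mathcal{B}w^*$, $z^*=\mathcal{C}x^*+\mathcal{D}w^*$, $w^*\in F(z^* )$, $z^*=\mathbf{1}_s\otimes\beta^*$, $(\mathbf{1}_s\otimes I_c)^\top w^*=0$ and $\lim_k(x_k,w_k,z_k)=(x^*,w^*,z^* )$ for all $x_0$. It is $\rho$-exponentially convergent for all $F\in\mathcal{O}_{m,L}$ if it is convergent for all such $F$ and there is $\gamma>0$ with $\max\{\|x_k-x^*\|_2,\|w_k-w^*\|_2,\|z_k-z^*\|_2\}\le\gamma\rho^k\|x_0-x^*\|_2$ for all $x_0$, $F\in\mathcal{O}_{m,L}$, $k\in\mathbb{N}$. Information constraint. $\mathcal{L}_{\mathrm{info}}\subseteq\mathbb{R}^{n_u\times n_y}$ is a set chosen such that $D_c\in\mathcal{L}_{\mathrm{info}}$ implies that the algorithm $F\star(P\star K)$ obeys a desired information constraint on $\mathcal{D}$; an example of such a constraint is that $\mathcal{D}$, partitioned into $c\times c$ blocks, be block-lower-triangular. Plant regulator equation for $(\Pi,\Gamma,\Phi)$: $A\Pi+(0\ \ B_1N)+B_2\Gamma=\Pi$, $C_1\Pi+(\mathbf{1}_s\otimes I_c\ \ D_1N)+D_{12}\Gamma=0$, $C_2\Pi+(0\ \ D_{21}N)+D_2\Gamma=\Phi$. Full-order internal model and subcontroller. $\Sigma_{\mathrm{full}}$: $\eta_{k+1}=\eta_k+\tilde u_k^1$, $u_k=-\Gamma\eta_k+\tilde u_k^2$, $\tilde y_k=\Phi\eta_k+y_k$ with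 $\eta_k\in\mathbb{R}^{cs}$. $\Sigma_{\mathrm f}$: $\zeta_{k+1}=A_f\zeta_k+B_f\tilde y_k$, $\tilde u^j_k=C_f^j\zeta_k+D_f^j\tilde y_k$, $j=1,2$. $K=\Sigma_{\mathrm{full}}\star\Sigma_{\mathrm f}$ is their interconnection from $y$ to $u$ with state $\xi=(\eta,\zeta)$; in particular $D_c=D_f^2$. Assumptions. Put $\mathbf{m}:=\mathrm{diag}(m)\otimes I_c$. Assumption 1: $E(\mathbf{m}):=I-D_1\mathbf{m}$ is invertible. With $W:=\mathbf{m}E(\mathbf{m})^{-1}$ set $A^{\mathbf m}=A+B_1WC_1$, $B_2^{\mathbf m}=B_2+B_1WD_{12}$, $C_2^{\mathbf m}=C_2+D_{21}WC_1$, $B_1^{\mathbf m}=(0\ \ B_1N)+B_1W(\mathbf{1}_s\otimes I_c\ \ D_1N)$, $D_{21}^{\mathbf m}=(0\ \ D_{21}N)+D_{21}W(\mathbf{1}_s\otimes I_c\ \ D_1N)$. Assumption 2: $(A^{\mathbf m},B_2^{\mathbf m})$ is stabilizable and $(A^{\mathbf m},C_2^{\mathbf m})$ is detectable. Assumption 3: $\begin{pmatrix} A-I & B_2 \\ C_1 & D_{12} \end{pmatrix}$ has full column rank. Assumption 4: $\left(\begin{pmatrix} A^{\mathbf m} & B_1^{\mathbf m} \\ 0 & I_{cs} \end{pmatrix},\ (C_2^{\mathbf m}\ \ D_{21}^{\mathbf m})\right)$ is detectable. Assumption 5: $\mathcal{L}^D\subseteq\mathbb{R}^{n_u\times n_y}$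 is a convex set with an LMI (linear matrix inequality) representation such that $X(I-D_2X)^{-1}\in\mathcal{L}_{\mathrm{info}}$ holds for all $X\in\mathcal{L}^D$. Filtered interconnection. Let $\boldsymbol{\sigma}:=\mathrm{diag}((L_1-m_1)^{-1},\dots,(L_s-m_s)^{-1})\otimes I_c$ (entry $0$ if $L_i=\infty$). The filtered interconnection is the system from $\bar q$ to $\bar r$ obtained from $\bar x_{k+1}=\rho^{-1}\mathcal{A}\bar x_k+\rho^{-1}\mathcal{B}\bar w_k$, $\bar z_k=\mathcal{C}\bar x_k+\mathcal{D}\bar w_k$, $\bar p_k=-\boldsymbol{\sigma}\bar q_k+\bar z_k$, $\bar w_k=\bar q_k+\mathbf{m}\bar z_k$ (eliminating $\bar w,\bar z$, possible if $I-\mathbf{m}\mathcal{D}$ is invertible), followed by the filters $\bar r^i_k=\sum_{\nu=0}^{\nu_{\max}}\lambda^i_\nu\bar p^i_{k-\nu}$, $i=1,\dots,s$, realized by shift registers storing $(\bar p^i_{k-1},\dots,\bar p^i_{k-\nu_{\max}})$ with zero initial state. Its realization $(\hat{\mathcal{A}},\hat{\mathcal{B}},\hat{\mathcal{C}}(\lambda),\hat{\mathcal{D}}(\lambda))$ has as state $\bar x_k$ together with the shift-register states. *)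

(* Defs.v *)
From HB Require Import structures.
From mathcomp Require Import all_boot all_order all_algebra.
From mathcomp Require Import all_classical all_reals all_analysis.
From mathcomp Require Import complex mxtens.

Set Implicit Arguments.
Unset Strict Implicit.
Unset Printing Implicit Defensive.

Import Order.TTheory GRing.Theory Num.Theory.
Import numFieldNormedType.Exports.

Local Open Scope classical_set_scope.
Local Open Scope ring_scope.

Definition edot (R : realType) (n : nat) (u v : 'cV[R]_n) : R :=
  \sum_i u i 0 * v i 0.

(* The library norm on matrices is the max norm, hence a separate 2-norm. *)
Definition enorm (R : realType) (n : nat) (u : 'cV[R]_n) : R :=
  Num.sqrt (edot u u).

Definition quad (R : realType) (n : nat) (x : 'cV[R]_n) : R :=
  2^-1 * enorm x ^+ 2.

Definition posdef (R : realType) (n : nat) (Q : 'M[R]_n) : Prop :=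
  forall v : 'cV[R]_n, v != 0 -> 0 < edot v (Q *m v).

Definition negdef (R : realType) (n : nat) (Q : 'M[R]_n) : Prop :=
  forall v : 'cV[R]_n, v != 0 -> edot v (Q *m v) < 0.

Definition possemidef (R : realType) (n : nat) (Q : 'M[R]_n) : Prop :=
  forall v : 'cV[R]_n, 0 <= edot v (Q *m v).

(* Discrete time: the spectrum lies in the open complex unit disc. *)
Definition schur_stable (R : realType) (n : nat) (A : 'M[R]_n) : Prop :=
  forall a : R[i], eigenvalue (map_mx (real_complex R) A) a -> `|a| < 1.

Definition stabilizable (R : realType) (n p : nat)
    (A : 'M[R]_n) (B : 'M[R]_(n, p)) : Prop :=
  exists G : 'M[R]_(p, n), schur_stable (A + B *m G).

Definition detectable (R : realType) (n q : nat)
    (A : 'M[R]_n) (C : 'M[R]_(q, n)) : Prop :=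
  exists G : 'M[R]_(n, q), schur_stable (A + G *m C).

(* Vectors of R^(sc) are s stacked blocks of size c, indexed as in the
   Kronecker product *t of mxtens. *)
Definition blk (R : realType) (s c : nat) (i : 'I_s) (z : 'cV[R]_(s * c)) :
    'cV[R]_c :=
  \col_j z (mxtens_index (i, j)) 0.

(* 1_s (x) I_c; the cast turns the column dimension 1 * c into c. *)
Definition ones_kron (R : realType) (s c : nat) : 'M[R]_(s * c, c) :=
  castmx (erefl (s * c)%N, mul1n c) ((const_mx 1 : 'cV[R]_s) *t 1%:M).

Definition diag_kron (R : realType) (s c : nat) (d : 'I_s -> R) :
    'M[R]_(s * c) :=
  diag_mx (\row_i d i) *t (1%:M : 'M[R]_c).

(* (L - m)^-1, read as 0 for L = +oo *)
Definition sector_width_inv (R : realType) (m : R) (L : \bar R) : R :=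
  if L is EFin l then (l - m)^-1 else 0.

Definition epigraph (R : realType) (c : nat) (g : 'cV[R]_c -> \bar R) :
    set ('cV[R]_c * R^o) :=
  [set p | (g p.1 <= (p.2 : R)%:E)%E].

Definition pcc (R : realType) (c : nat) (g : 'cV[R]_c -> \bar R) : Prop :=
  [/\ (forall x, g x != -oo%E) /\ (exists x, g x != +oo%E),
      convex_set (epigraph g) &
      closed (epigraph g)].

Definition classS (R : realType) (c : nat) (m : R) (L : \bar R)
    (f : 'cV[R]_c -> \bar R) : Prop :=
  pcc (fun x => f x - (m * quad x)%:E)%E /\
  (forall l : R, L = l%:E -> pcc (fun x => (l * quad x)%:E - f x)%E).

Definition convex_subdiff (R : realType) (c : nat) (g : 'cV[R]_c -> \bar R)
    (x : 'cV[R]_c) : set 'cV[R]_c :=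
  [set v | forall y, (g x + (edot v (y - x))%:E <= g y)%E].

Definition subdiff (R : realType) (c : nat) (m : R) (f : 'cV[R]_c -> \bar R)
    (x : 'cV[R]_c) : set 'cV[R]_c :=
  [set v + m *: x | v in convex_subdiff (fun y => f y - (m * quad y)%:E)%E x].

Definition operator (R : realType) (n : nat) := 'cV[R]_n -> set 'cV[R]_n.

Definition classO (R : realType) (s c : nat) (m : 'I_s -> R)
    (L : 'I_s -> \bar R) : set (operator R (s * c)) :=
  [set F | exists f : 'I_s -> 'cV[R]_c -> \bar R,
    [/\ forall i, classS (m i) (L i) (f i),
        forall z, F z =
          [set w | forall i, subdiff (m i) (f i) (blk i z) (blk i w)] &
        exists! bw : 'cV[R]_c * 'cV[R]_(s * c),
          \sum_i blk i bw.2 = 0 /\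
          forall i, subdiff (m i) (f i) bw.1 (blk i bw.2)]].

Definition op_inv (R : realType) (n : nat) (F : operator R n) : operator R n :=
  fun x => [set y | F y x].

Definition op_sub_mx (R : realType) (n : nat) (F : operator R n)
    (D : 'M[R]_n) : operator R n :=
  fun x => [set y - D *m x | y in F x].

Definition globally_continuous (R : realType) (n : nat) (F : operator R n) :
    Prop :=
  exists2 g : 'cV[R]_n -> 'cV[R]_n,
    continuous g & forall v, F v = [set g v].

(* state dimension n, input dimension p, output dimension q *)
Record lti (R : realType) (n p q : nat) := LTI {
  sA : 'M[R]_n;
  sB : 'M[R]_(n, p);
  sC : 'M[R]_(q, n);
  sD : 'M[R]_(q, p) }.

(* state n, performance channel w (dim p) to z (dim q),
   control channel u (dim nu) to y (dim ny) *)
Record network (R : realType) (n p q nu ny : nat) := Network {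
  nA : 'M[R]_n;        nB1 : 'M[R]_(n, p);   nB2 : 'M[R]_(n, nu);
  nC1 : 'M[R]_(q, n);  nD1 : 'M[R]_(q, p);   nD12 : 'M[R]_(q, nu);
  nC2 : 'M[R]_(ny, n); nD21 : 'M[R]_(ny, p); nD2 : 'M[R]_(ny, nu) }.

Definition star_wellposed (R : realType) (n p q nu ny nk : nat)
    (P : network R n p q nu ny) (K : lti R nk ny nu) : Prop :=
  1%:M - nD2 P *m sD K \in unitmx.

(* Elimination of y = E (C2 x + D21 w + D2 Cc xi), u = Cc xi + Dc y,
   with E = (I - D2 Dc)^-1. *)
Definition star (R : realType) (n p q nu ny nk : nat)
    (P : network R n p q nu ny) (K : lti R nk ny nu) : lti R (n + nk) p q :=
  let E := invmx (1%:M - nD2 P *m sD K) in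
  let Cu := sC K + sD K *m E *m nD2 P *m sC K in
  LTI
    (block_mx (nA P + nB2 P *m sD K *m E *m nC2 P)
              (nB2 P *m Cu)
              (sB K *m E *m nC2 P)
              (sA K + sB K *m E *m nD2 P *m sC K))
    (col_mx (nB1 P + nB2 P *m sD K *m E *m nD21 P)
            (sB K *m E *m nD21 P))
    (row_mx (nC1 P + nD12 P *m sD K *m E *m nC2 P)
            (nD12 P *m Cu))
    (nD1 P + nD12 P *m sD K *m E *m nD21 P).

(* Sigma_full as a network with w = y, z = u, control input (ut1, ut2) and
   measurement yt, so that K = star (full_model Gamma Phi) Sigma_f. *)
Definition full_model (R : realType) (d nu ny : nat)
    (Gamma : 'M[R]_(nu, d)) (Phi : 'M[R]_(ny, d)) :
    network R d ny nu (d + nu) ny :=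
  Network
    (1%:M : 'M[R]_d) (0 : 'M[R]_(d, ny)) (row_mx 1%:M 0 : 'M[R]_(d, d + nu))
    (- Gamma)     (0 : 'M[R]_(nu, ny)) (row_mx 0 1%:M : 'M[R]_(nu, d + nu))
    Phi           (1%:M : 'M[R]_ny)    (0 : 'M[R]_(ny, d + nu)).

Definition alg_wellposed (R : realType) (n p : nat) (F : operator R p)
    (G : lti R n p p) : Prop :=
  globally_continuous (op_inv (op_sub_mx (op_inv F) (sD G))).

Definition trajectory (R : realType) (n p : nat) (F : operator R p)
    (G : lti R n p p) (x : nat -> 'cV[R]_n) (w z : nat -> 'cV[R]_p) : Prop :=
  forall k, [/\ x k.+1 = sA G *m x k + sB G *m w k,
                z k = sC G *m x k + sD G *m w k &
                F (z k) (w k)].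

Definition convergence_point (R : realType) (n s c : nat)
    (F : operator R (s * c)) (G : lti R n (s * c) (s * c))
    (xs : 'cV[R]_n) (ws zs : 'cV[R]_(s * c)) : Prop :=
  [/\ [/\ xs = sA G *m xs + sB G *m ws,
          zs = sC G *m xs + sD G *m ws &
          F zs ws],
      exists b : 'cV[R]_c, zs = ones_kron R s c *m b,
      (ones_kron R s c)^T *m ws = 0 &
      forall x w z, trajectory F G x w z ->
        [/\ x @ \oo --> xs, w @ \oo --> ws & z @ \oo --> zs]].

Definition convergent (R : realType) (n s c : nat)
    (F : operator R (s * c)) (G : lti R n (s * c) (s * c)) : Prop :=
  exists xs ws zs, convergence_point F G xs ws zs.

Definition exp_convergent (R : realType) (n s c : nat) (rho : R)
    (O : set (operator R (s * c))) (G : lti R n (s * c) (s * c)) : Prop :=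
  (forall F, O F -> convergent F G) /\
  exists2 gamma : R, 0 < gamma &
    forall F, O F ->
    forall xs ws zs, convergence_point F G xs ws zs ->
    forall x w z, trajectory F G x w z ->
    forall k, Num.max (enorm (x k - xs))
                (Num.max (enorm (w k - ws)) (enorm (z k - zs)))
              <= gamma * rho ^+ k * enorm (x 0%N - xs).

Definition consensus_matrix (R : realType) (s c : nat)
    (N : 'M[R]_(s * c, s.-1 * c)) : Prop :=
  (\rank N = s.-1 * c)%N /\
  (forall v : 'cV[R]_(s * c),
     (exists u, v = N *m u) <-> (ones_kron R s c)^T *m v = 0).

Definition regulator_solution (R : realType) (n s c nu ny : nat)
    (P : network R n (s * c) (s * c) nu ny) (N : 'M[R]_(s * c, s.-1 * c))
    (Pi : 'M[R]_(n, c + s.-1 * c)) (Gamma : 'M[R]_(nu, c + s.-1 * c))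
    (Phi : 'M[R]_(ny, c + s.-1 * c)) : Prop :=
  [/\ nA P *m Pi + row_mx 0 (nB1 P *m N) + nB2 P *m Gamma = Pi,
      nC1 P *m Pi + row_mx (ones_kron R s c) (nD1 P *m N)
        + nD12 P *m Gamma = 0 &
      nC2 P *m Pi + row_mx 0 (nD21 P *m N) + nD2 P *m Gamma = Phi].

Definition pencil (R : realType) (a b k : nat) (G0 : 'M[R]_k)
    (G : 'I_a -> 'I_b -> 'M[R]_k) (X : 'M[R]_(a, b)) : 'M[R]_k :=
  G0 + \sum_i \sum_j X i j *: G i j.

(* Non-strict and strict affine matrix inequalities are both allowed; several
   inequalities of one kind combine into a block-diagonal one, and size 0 gives
   a void constraint. *)
Definition lmi_representable (R : realType) (a b : nat)
    (S : set 'M[R]_(a, b)) : Prop :=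
  exists (k l : nat) (G0 : 'M[R]_k) (G : 'I_a -> 'I_b -> 'M[R]_k)
         (H0 : 'M[R]_l) (H : 'I_a -> 'I_b -> 'M[R]_l),
    [/\ G0^T = G0 /\ (forall i j, (G i j)^T = G i j),
        H0^T = H0 /\ (forall i j, (H i j)^T = H i j) &
        S = [set X | possemidef (pencil G0 G X) /\ posdef (pencil H0 H X)]].

(* Linfo guarantees, for every well-posed controller, that the direct
   feedthrough of the closed loop satisfies the constraint Dspec. *)
Definition information_set (R : realType) (n p nu ny : nat)
    (P : network R n p p nu ny) (Dspec : set 'M[R]_p)
    (Linfo : set 'M[R]_(nu, ny)) : Prop :=
  forall (nk : nat) (K : lti R nk ny nu), star_wellposed P K ->
    Linfo (sD K) -> Dspec (sD (star P K)).

Section Assumptions.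
Context (R : realType) (n s c nu ny : nat).
Context (P : network R n (s * c) (s * c) nu ny).
Context (N : 'M[R]_(s * c, s.-1 * c)) (m : 'I_s -> R).

Let mm := diag_kron c m.
Let W := mm *m invmx (1%:M - nD1 P *m mm).
Let J := row_mx (ones_kron R s c) (nD1 P *m N).

Definition Am := nA P + nB1 P *m W *m nC1 P.
Definition B2m := nB2 P + nB1 P *m W *m nD12 P.
Definition C2m := nC2 P + nD21 P *m W *m nC1 P.
Definition B1m := row_mx 0 (nB1 P *m N) + nB1 P *m W *m J.
Definition D21m := row_mx 0 (nD21 P *m N) + nD21 P *m W *m J.

Definition assumption1 : Prop := 1%:M - nD1 P *m mm \in unitmx.

Definition assumption2 : Prop := stabilizable Am B2m /\ detectable Am C2m.

Definition assumption3 : Prop :=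
  \rank (block_mx (nA P - 1%:M) (nB2 P) (nC1 P) (nD12 P)) = (n + nu)%N.

Definition assumption4 : Prop :=
  detectable (block_mx Am B1m 0 1%:M) (row_mx C2m D21m).

Definition assumption5 (Linfo LD : set 'M[R]_(nu, ny)) : Prop :=
  [/\ convex_set LD,
      lmi_representable LD &
      forall X, LD X -> 1%:M - nD2 P *m X \in unitmx ->
        Linfo (X *m invmx (1%:M - nD2 P *m X))].
End Assumptions.

Section Filtered.
Context (R : realType) (n s c : nat) (G : lti R n (s * c) (s * c)).
Context (m : 'I_s -> R) (L : 'I_s -> \bar R) (rho : R).

Let mm := diag_kron c m.
Let sigma := diag_kron c (fun i => sector_width_inv (m i) (L i)).
Let H := invmx (1%:M - mm *m sD G).

(* From qbar to pbar, by elimination of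
   wbar = H (qbar + mm C xbar) and zbar = C xbar + D wbar. *)
Definition scaled_loop : lti R n (s * c) (s * c) :=
  LTI
    (rho^-1 *: (sA G + sB G *m H *m mm *m sC G))
    (rho^-1 *: (sB G *m H))
    (sC G + sD G *m H *m mm *m sC G)
    (sD G *m H - sigma).

Context (numax : nat) (lam : 'I_s -> 'I_numax.+1 -> R).

Definition tap (nu : 'I_numax.+1) : 'M[R]_(s * c) :=
  diag_kron c (lam^~ nu).

(* The shift registers of all channels, stacked by delay: block j of the
   state is pbar_(k - j - 1). *)
Definition fir_filter :
    lti R (\sum_(j < numax) (s * c)) (s * c) (s * c) :=
  LTI
    (\mxblock_(i < numax, j < numax) ((i == j.+1 :> nat)%:R%:M : 'M[R]_(s * c)))
    (\mxcol_(i < numax) ((i == 0%N :> nat)%:R%:M : 'M[R]_(s * c)))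
    (\mxrow_(j < numax) tap (lift ord0 j))
    (tap ord0).

Definition filtered :
    lti R (n + \sum_(j < numax) (s * c)) (s * c) (s * c) :=
  let S := scaled_loop in
  let T := fir_filter in
  LTI
    (block_mx (sA S) 0 (sB T *m sC S) (sA T))
    (col_mx (sB S) (sB T *m sD S))
    (row_mx (sD T *m sC S) (sC T))
    (sD T *m sD S).
End Filtered.

Definition passivity_lmi (R : realType) (n p : nat) (G : lti R n p p)
    (M : 'M[R]_n) : Prop :=
  let X := block_mx (sA G) (sB G) 1%:M 0 in
  let Y := block_mx (sC G) (sD G) 0 1%:M in
  negdef (X^T *m block_mx M 0 0 (- M) *m X
          + 2^-1 *: (Y^T *m block_mx 0 1%:M 1%:M 0 *m Y)).

(* Main.v *)
Require Import Defs.
From HB Require Import structures.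
From mathcomp Require Import all_boot all_order all_algebra.
From mathcomp Require Import all_classical all_reals all_analysis.
From mathcomp Require Import mxtens ring lra.

Set Implicit Arguments.
Unset Strict Implicit.
Unset Printing Implicit Defensive.

Import Order.TTheory GRing.Theory Num.Theory.
Import numFieldNormedType.Exports.

Local Open Scope classical_set_scope.
Local Open Scope ring_scope.

(** Subtracting [m_i] from the i-th subdifferential and removing the sector width
    by loop shifting turns the operator into the subdifferential of a convex
    function in each block: [q = w - m z] is a subgradient at
    [p = z - sigma q].  This is the interpolation inequality of smooth convex
    functions ([sector_value_le]), and the filtered interconnection is the
    plant as seen by these signals, weighted by [rho ^ -k].

    Well-posedness.  Since [M] is positive definite, the lower right block of the
    matrix inequality makes [lam_0 (D H - sigma)] negative definite
    ([feedthrough_negdef]), with [D] the direct feedthrough of the closed loop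
    and [H] the inverse of [I - m D].  The algebraic loop is then a strongly
    monotone inclusion.  A
    contraction built from proximal steps solves it ([loop_solvable]), and strong
    monotonicity makes the solution unique and Lipschitz ([loop_lipschitz]).  The
    proximal points come from minimizing a strongly convex function with closed
    epigraph ([pcc_prox]).

    Equilibrium.  The optimality conditions of the class provide a consensus value
    and a balanced [w].  Writing [w = N v], the plant regulator equation and the
    internal model produce a steady state of the closed loop
    ([regulator_equilibrium]).

    Exponential convergence.  The sign conditions on the filter coefficients give
    the Zames-Falb inequality for the weighted signals ([zames_falb],
    [supply_ge0]): the filtered output [r] satisfies [sum_(k < T) <r_k, q_k> >= 0]
    for all [T].  The matrix inequality is a strict dissipation inequality with
    storage [<x, M x>]; added up, it bounds the weighted deviations from the
    equilibrium by the initial deviation ([passivity_lmi_bounded]).  Undoing the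
    weights gives the rate [rho], with a constant that depends only on the
    matrices ([exponential_bound]). *)

(** * Euclidean geometry of column vectors *)

Section Euclid.
Variables (R : realType) (n : nat).
Implicit Types (u v w : 'cV[R]_n) (a : R).

Lemma edotE u v : edot u v = (u^T *m v) 0 0.
Proof. by rewrite !mxE; apply: eq_bigr => i _; rewrite mxE. Qed.

Lemma edotC u v : edot u v = edot v u.
Proof. by apply: eq_bigr => i _; rewrite mulrC. Qed.

Lemma edotDr u v w : edot u (v + w) = edot u v + edot u w.
Proof. by rewrite -big_split; apply: eq_bigr => i _; rewrite mxE mulrDr. Qed.

Lemma edotZr a u v : edot u (a *: v) = a * edot u v.
Proof. by rewrite mulr_sumr; apply: eq_bigr => i _; rewrite mxE mulrCA. Qed.

Lemma edotNr u v : edot u (- v) = - edot u v.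
Proof. by rewrite -scaleN1r edotZr mulN1r. Qed.

Lemma edotBr u v w : edot u (v - w) = edot u v - edot u w.
Proof. by rewrite edotDr edotNr. Qed.

Lemma edotDl u v w : edot (v + w) u = edot v u + edot w u.
Proof. by rewrite edotC edotDr !(edotC u). Qed.

Lemma edotZl a u v : edot (a *: v) u = a * edot v u.
Proof. by rewrite edotC edotZr edotC. Qed.

Lemma edotNl u v : edot (- v) u = - edot v u.
Proof. by rewrite edotC edotNr edotC. Qed.

Lemma edotBl u v w : edot (v - w) u = edot v u - edot w u.
Proof. by rewrite edotDl edotNl. Qed.

Lemma edot0r u : edot u 0 = 0.
Proof. by rewrite -(scale0r 0) edotZr mul0r. Qed.

Lemma edot0l u : edot 0 u = 0.
Proof. by rewrite edotC edot0r. Qed.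

Lemma edot_sumr I (r : seq I) (Q : pred I) (F : I -> 'cV[R]_n) u :
  edot u (\sum_(i <- r | Q i) F i) = \sum_(i <- r | Q i) edot u (F i).
Proof.
by apply: (big_morph (edot u)) => [x y|]; rewrite ?edot0r ?edotDr.
Qed.

Lemma edot_ge0 u : 0 <= edot u u.
Proof. by apply: sumr_ge0 => i _; rewrite -expr2 sqr_ge0. Qed.

Lemma edot_eq0 u : (edot u u == 0) = (u == 0).
Proof.
apply/idP/eqP => [|->]; last by rewrite edot0r.
rewrite psumr_eq0 => [/allP h|i _]; last by rewrite -expr2 sqr_ge0.
apply/colP => i; have := h i; rewrite mem_index_enum mulf_eq0 orbb mxE.
by move=> /(_ isT)/eqP.
Qed.

Lemma edot_gt0 u : (0 < edot u u) = (u != 0).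
Proof. by rewrite lt_def edot_eq0 edot_ge0 andbT. Qed.

Definition edotLR := (edotDr, edotDl, edotBr, edotBl, edotNr, edotNl,
  edotZr, edotZl, edot0r, edot0l).

Lemma enorm_sqr u : enorm u ^+ 2 = edot u u.
Proof. by rewrite /enorm sqr_sqrtr // edot_ge0. Qed.

Lemma enorm_ge0 u : 0 <= enorm u.
Proof. exact: sqrtr_ge0. Qed.

Lemma enorm_le u (b : R) : 0 <= b -> edot u u <= b ^+ 2 -> enorm u <= b.
Proof. by move=> b0 h; rewrite -(ger0_norm b0) -sqrtr_sqr ler_wsqrtr. Qed.

Lemma sqr_coord_le_edot u i : u i 0 ^+ 2 <= edot u u.
Proof.
rewrite /edot (bigD1 i) //= -expr2 lerDl.
by apply: sumr_ge0 => j _; rewrite -expr2 sqr_ge0.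
Qed.

Lemma norm_le_enorm u : `|u| <= enorm u.
Proof.
rewrite -[`|u|]/(mx_norm u) mx_normrE; apply/bigmax_leP.
split=> [|[i j] _]; first exact: enorm_ge0.
by rewrite ord1 /= -sqrtr_sqr ler_wsqrtr // sqr_coord_le_edot.
Qed.

Lemma edot_le_norm u : edot u u <= n%:R * `|u| ^+ 2.
Proof.
rewrite mulr_natl -[n in _ *+ n]card_ord -sumr_const; apply: ler_sum => i _.
rewrite -expr2 -real_normK ?num_real // lerXn2r ?nnegrE //.
rewrite -[`|u|]/(mx_norm u) mx_normrE.
exact: (le_bigmax _ (fun ij : 'I_n * 'I_1 => `|u ij.1 ij.2|) (i, 0)).
Qed.

End Euclid.

Lemma edot_mulmxr (R : realType) n p (A : 'M[R]_(n, p)) u v :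
  edot u (A *m v) = edot (A^T *m u) v.
Proof. by rewrite !edotE trmx_mul trmxK mulmxA. Qed.

Lemma edot_col_mx (R : realType) n p (u1 v1 : 'cV[R]_n) (u2 v2 : 'cV[R]_p) :
  edot (col_mx u1 u2) (col_mx v1 v2) = edot u1 v1 + edot u2 v2.
Proof.
rewrite /edot big_split_ord /=; congr (_ + _); apply: eq_bigr => i _.
  by rewrite !col_mxEu.
by rewrite !col_mxEd.
Qed.

(** Nonnegativity of a quadratic polynomial in one variable along the pencil
    [u - t v]; it covers both the Euclidean form and the form of a positive
    definite matrix. *)
Lemma form_CauchySchwarz (R : realType) n (Q : 'M[R]_n) (u v : 'cV[R]_n) :
  Q^T = Q -> posdef Q ->
  edot u (Q *m v) ^+ 2 <= edot u (Q *m u) * edot v (Q *m v).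
Proof.
move=> Qs Qp; have [->|v0] := eqVneq v 0.
  by rewrite mulmx0 !edot0r mulr0 expr0n.
have Qv := Qp v v0; set a := edot u (Q *m v).
set b := edot v (Q *m v) in Qv *; set c := edot u (Q *m u).
have vu : edot v (Q *m u) = a by rewrite edot_mulmxr Qs edotC.
have : 0 <= edot (b *: u - a *: v) (Q *m (b *: u - a *: v)).
  have [->|/Qp/ltW//] := eqVneq (b *: u - a *: v) 0; by rewrite edot0l.
rewrite mulmxBr -!scalemxAr !edotLR -/a -/b -/c vu.
rewrite [X in 0 <= X -> _](_ : _ = b * (c * b - a ^+ 2)); last by ring.
by rewrite pmulr_rge0 // subr_ge0.
Qed.

Lemma posdef1 (R : realType) n : posdef (1%:M : 'M[R]_n).
Proof. by move=> v v0; rewrite mul1mx edot_gt0. Qed.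

Lemma CauchySchwarz (R : realType) n (u v : 'cV[R]_n) :
  edot u v ^+ 2 <= edot u u * edot v v.
Proof.
have := form_CauchySchwarz u v (trmx1 R n) (@posdef1 R n).
by rewrite !mul1mx.
Qed.

Lemma enorm_CauchySchwarz (R : realType) n (u v : 'cV[R]_n) :
  edot u v <= enorm u * enorm v.
Proof.
rewrite -sqrtrM ?edot_ge0 // (le_trans (ler_norm _)) // -sqrtr_sqr.
by rewrite ler_wsqrtr // CauchySchwarz.
Qed.

Lemma mulmx_bounded (R : realType) n p (A : 'M[R]_(n, p)) :
  exists2 K : R, 0 < K &
    forall v, edot (A *m v) (A *m v) <= K * edot v v.
Proof.
have rowE (i : 'I_n) v : (A *m v) i 0 = edot (row i A)^T v.
  by rewrite mxE; apply: eq_bigr => j _; rewrite !mxE.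
exists (1 + \sum_i edot (row i A)^T (row i A)^T) => [|v].
  by rewrite ltr_pwDl // sumr_ge0 // => i _; rewrite edot_ge0.
rewrite mulrDl mul1r mulr_suml ler_wpDl ?edot_ge0 //.
by apply: ler_sum => i _; rewrite rowE -expr2 CauchySchwarz.
Qed.

Lemma edot_triangle (R : realType) n (u v : 'cV[R]_n) :
  edot (u + v) (u + v) <= 2 * edot u u + 2 * edot v v.
Proof.
by have := edot_ge0 (u - v); rewrite !edotLR (edotC v u); lra.
Qed.

(** A definite quadratic form dominates a multiple of the Euclidean one.
    Cauchy-Schwarz for the form of [Q], applied to [u] and [invmx Q *m e_i],
    bounds the square of the i-th coordinate of [u] by
    [<u, Q u> * (invmx Q) i i]; after summation over [i] the constant is the
    inverse of one plus the trace of [invmx Q]. *)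
Lemma posdef_coercive (R : realType) n (Q : 'M[R]_n) :
  Q^T = Q -> posdef Q ->
  exists2 e : R, 0 < e & forall u, e * edot u u <= edot u (Q *m u).
Proof.
move=> Qs Qp.
have Qu : Q \in unitmx.
  rewrite -row_free_unit -kermx_eq0; apply/rowV0P => v /sub_kermxP vQ.
  apply: contraTeq isT => v0; have /Qp : v^T != 0 by rewrite trmx_eq0.
  by rewrite edot_mulmxr -trmx_mul vQ trmx0 edot0l ltxx.
have pos u : 0 <= edot u (Q *m u).
  have [->|/Qp/ltW//] := eqVneq u 0; by rewrite edot0l.
pose t i := edot (invmx Q *m delta_mx i 0) (Q *m (invmx Q *m delta_mx i 0)).
pose T := 1 + \sum_i t i.
have T0 : 0 < T by rewrite ltr_pwDl // sumr_ge0 // => i _; exact: pos.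
exists T^-1 => [|u]; first by rewrite invr_gt0.
rewrite ler_pdivrMl // mulrDl mul1r ler_wpDl // mulr_suml.
apply: ler_sum => i _; rewrite [leRHS]mulrC.
have -> : u i 0 * u i 0 = edot u (Q *m (invmx Q *m delta_mx i 0)) ^+ 2.
  rewrite mulKVmx // -expr2; congr (_ ^+ 2).
  rewrite /edot (bigD1 i) //= big1 ?addr0 => [|j ji]; rewrite !mxE.
    by rewrite !eqxx mulr1.
  by rewrite (negPf ji) mulr0.
exact: form_CauchySchwarz.
Qed.

Lemma negdef_coercive (R : realType) n (Q : 'M[R]_n) :
  negdef Q ->
  exists2 e : R, 0 < e & forall u, edot u (Q *m u) <= - (e * edot u u).
Proof.
move=> Qn; pose S := - (Q + Q^T).
have formE u : edot u (S *m u) = - (edot u (Q *m u) *+ 2).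
  rewrite mulNmx edotNr mulmxDl edotDr (edot_mulmxr Q^T) trmxK.
  by rewrite (edotC (Q *m u)) mulr2n.
have [||e e0 he] := @posdef_coercive R n S.
- by rewrite linearN linearD /= trmxK addrC.
- by move=> v /Qn h; rewrite formE oppr_gt0 pmulrn_llt0.
exists (e / 2) => [|u]; first by rewrite divr_gt0.
by have := he u; rewrite formE mulr2n; lra.
Qed.

(** * Closed convex functions: minimization, proximal points *)

Lemma trmx_continuous (R : realType) m n : continuous (@trmx R m n).
Proof.
move=> M S /= /(nbhs_ballP (M^T)) [e e0 es].
apply/nbhs_ballP; exists e => //= N [_ MN].
by apply: es; split => // i j; rewrite !mxE.
Qed.

Lemma cV_bounded_closed_compact (R : realType) n (A : set 'cV[R]_n) :
  bounded_set A -> closed A -> compact A.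
Proof.
move=> bA cA.
rewrite (_ : A = trmx @` (trmx @^-1` A)); last first.
  apply/seteqP; split=> [x Ax|_ [y Ay <-]//].
  by exists x^T; rewrite /= trmxK.
apply: continuous_compact; first exact/continuous_subspaceT/trmx_continuous.
apply: bounded_closed_compact.
  case: bA => M [Mr hM]; exists M; split=> // x xM v /= /(hM x xM).
  apply: le_trans; rewrite -[`|v|]/(mx_norm v) -[`|v^T|]/(mx_norm v^T) !mx_normrE.
  apply/bigmax_leP; split=> [|[i j] _]; first exact: bigmax_ge_id.
  have := le_bigmax 0 (fun ij : 'I_n * 'I_1 => `|v^T ij.1 ij.2|) (j, i).
  by rewrite /= mxE.
by apply: closed_comp cA => v _; exact: trmx_continuous.
Qed.

Lemma edot_dist_continuous (R : realType) n (a : 'cV[R]_n) :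
  continuous (fun x : 'cV[R]_n => edot (x - a) (x - a)).
Proof.
rewrite /edot; apply: (@continuous_big R _ +%R 0) => [|i _ x].
  exact: add_continuous.
have h : {for x, continuous (fun y : 'cV[R]_n => (y - a) i 0)}.
  rewrite (_ : (fun y : 'cV[R]_n => _) = (fun y => y i 0 - a i 0)); last first.
    by apply/funext => y; rewrite !mxE.
  by apply: continuousB; [exact: coord_continuous|exact: cst_continuous].
exact: (continuousM h h).
Qed.

Lemma ball_compact (R : realType) n (a : 'cV[R]_n) (r : R) :
  compact [set x : 'cV[R]_n | edot (x - a) (x - a) <= r].
Proof.
apply: cV_bounded_closed_compact.
  exists (Num.sqrt r + `|a|); split=> [|M rM x /= xr]; first exact: num_real.
  apply: le_trans (ltW rM); rewrite -{1}(subrK a x).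
  apply: (le_trans (ler_normD _ _)); rewrite lerD2r.
  by apply: (le_trans (norm_le_enorm _)); exact: ler_wsqrtr.
pose f (x : 'cV[R]_n) := edot (x - a) (x - a).
apply: (@preimage_closed _ _ f [set y | y <= r]) (@closed_le _ r) => x _.
exact: edot_dist_continuous.
Qed.

(** Weierstrass' theorem for an extended-valued function with closed sublevel
    sets: those above the infimum are nested, so they form a filter on [K], and
    a cluster point lies in all of them. *)
Lemma compact_min (R : realType) (T : topologicalType) (K : set T)
    (phi : T -> \bar R) :
  compact K -> K !=set0 -> (forall r : R, closed [set x | (phi x <= r%:E)%E]) ->
  exists2 x, K x & forall y, K y -> (phi x <= phi y)%E.
Proof.
move=> cK [x0 Kx0] cphi.
pose I := ereal_inf (phi @` K).
have [allI|] := pselect (forall y, K y -> phi y = +oo%E).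
  by exists x0 => // y /allI ->; rewrite leey.
move/existsNP => [y0 /not_implyP[Ky0 /eqP y0oo]].
pose S (r : R) := K `&` [set x | (phi x <= r%:E)%E].
pose D := [set r : R | (I < r%:E)%E].
have SD r : D r -> S r !=set0.
  move=> /ereal_inf_lt [_ [x Kx <-] xr]; exists x; split => //; exact: ltW.
have [r0 Dr0] : exists r, D r.
  have : (I <= phi y0)%E by apply: ereal_inf_lbound; exists y0.
  rewrite /D /=; case: (phi y0) y0oo => [r| |] //= _ Ir.
    by exists (r + 1); rewrite (le_lt_trans Ir) // lte_fin ltrDl.
  by exists 0; rewrite (le_lt_trans Ir) // ltNyr.
have FF : ProperFilter (filter_from D S).
  apply: filter_from_proper => [|r /SD//].
  apply: filter_from_filter; first by exists r0.
  move=> r t Dr Dt; exists (Num.min r t) => [|x [Kx /= xrt]].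
    by rewrite /D /= minEle; case: ifP.
  split; split=> //=; apply: (le_trans xrt); rewrite lee_fin ge_min lexx ?orbT //.
have [|x [Kx xcl]] := cK _ FF; first by exists r0 => // ? [].
exists x => // y Ky.
apply: (@le_trans _ _ I); last by apply: ereal_inf_lbound; exists y.
have xr r : D r -> (phi x <= r%:E)%E.
  move=> Dr; apply: (cphi r) => B /(xcl (S r)) h.
  have [|z [[_ zr] Bz]] := h; first by exists r.
  by exists z.
rewrite leNgt; apply/negP => Ix.
case: I @D Ix {SD Dr0 FF xcl S} xr => [i| |] /= Ix xr.
- have : (phi x <= i%:E)%E.
    apply/lee_addgt0Pr => e e0; rewrite -EFinD; apply: xr.
    by rewrite lte_fin ltrDl.
  by rewrite leNgt Ix.
- by rewrite ltNge leey in Ix.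
- case: (phi x) Ix xr => [t| |] // _ xr.
    by have := xr (t - 1) (ltNyr _); rewrite lee_fin; lra.
  by have := xr 0 (ltNyr _).
Qed.

Lemma le_of_perturb (R : realFieldType) (a b c : R) :
  (forall t, 0 < t < 1 -> a <= b + t * c) -> a <= b.
Proof.
move=> h; rewrite leNgt; apply/negP => ba.
pose d := a - b; have d0 : 0 < d by rewrite subr_gt0.
pose e := 2 * d + `|c|; have e0 : 0 < e by rewrite ltr_wpDr // mulr_gt0.
have t01 : 0 < d / e < 1.
  rewrite divr_gt0 // ltr_pdivrMr // mul1r /e.
  by have := normr_ge0 c; lra.
have := h _ t01; apply/negP; rewrite -ltNge -ltrBrDl -/d.
rewrite mulrAC ltr_pdivrMr // ltr_pM2l //.
by rewrite /e (le_lt_trans (ler_norm c)) // ltrDr mulr_gt0.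
Qed.

Lemma quadE (R : realType) c (x : 'cV[R]_c) : quad x = edot x x / 2.
Proof. by rewrite /quad enorm_sqr mulrC. Qed.

Section ClosedConvex.
Variables (R : realType) (c : nat) (g : 'cV[R]_c -> \bar R).
Hypothesis pg : pcc g.

Lemma pcc_segment (x y : 'cV[R]_c) (a b t : R) : 0 <= t <= 1 ->
  (g x <= a%:E)%E -> (g y <= b%:E)%E ->
  (g (t *: x + (1 - t) *: y) <= (t * a + (1 - t) * b)%:E)%E.
Proof.
case: pg => _ cg _ /andP[t0 t1] xa yb.
have := cg (x, a) (y, b) (Itv01 t0 t1); rewrite !in_setE.
exact.
Qed.

Lemma pcc_fin (x : 'cV[R]_c) (b : R) :
  (g x <= b%:E)%E -> g x = (fine (g x))%:E.
Proof.
case: pg => -[/(_ x) gx _] _ _ xb; rewrite fineK // fin_numE gx.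
by apply: contraTneq xb => ->.
Qed.

Lemma pcc_dom : exists x, g x = (fine (g x))%:E.
Proof.
case: pg => -[gN [x gx]] _ _; exists x.
by rewrite fineK // fin_numE gN gx.
Qed.

Lemma subdiff_fin (x v : 'cV[R]_c) :
  convex_subdiff g x v -> g x = (fine (g x))%:E.
Proof.
have [y gy] := pcc_dom; move=> /(_ y); rewrite gy.
case: pg => -[/(_ x) gx _] _ _; move: gx; case: (g x) => //.
Qed.

Lemma pcc_sublevel (h : 'cV[R]_c -> R) (r : R) : continuous h ->
  closed [set x | (g x + (h x)%:E <= r%:E)%E].
Proof.
case: pg => _ _ cg ch.
pose k (x : 'cV[R]_c) : 'cV[R]_c * R^o := (x, r - h x).
have -> : [set x | (g x + (h x)%:E <= r%:E)%E] = k @^-1` epigraph g.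
  apply/seteqP; split=> x /=; rewrite /epigraph /= EFinB leeBrDr //.
apply: (@preimage_closed _ _ k) cg => x _.
apply: (@cvg_pair _ _ _ (nbhs x) (nbhs x) (nbhs (r - h x : R^o))) => //.
by apply: cvgB; [exact: cvg_cst|exact: ch].
Qed.

(** The proximal point of [a] is the minimizer of [g] plus a multiple of the
    squared distance to [a].  The strong convexity of that sum does all the
    work.  Compared on a unit ball about a point [x0] of the domain, where a
    minimum exists by compactness, it confines the sublevel set of [x0] to a
    larger ball, so that a global minimizer [z] exists; and it makes the sum
    grow quadratically away from [z], which is the subgradient inequality. *)
Lemma pcc_prox (k : R) (a : 'cV[R]_c) : 0 < k ->
  exists z, convex_subdiff g z (k^-1 *: (a - z)).
Proof.
move=> k0; pose h (x : 'cV[R]_c) := edot (x - a) (x - a) / (2 * k).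
pose phi x := (g x + (h x)%:E)%E.
have hc : continuous h.
  pose e (x : 'cV[R]_c) : R := edot (x - a) (x - a).
  rewrite (_ : h = e \* cst (2 * k)^-1) // => x.
  apply: continuousM; [exact: edot_dist_continuous|exact: cst_continuous].
have phic (r : R) : closed [set x | (phi x <= r%:E)%E] := pcc_sublevel hc.
have phi_fin x r : (phi x <= r%:E)%E -> phi x = (fine (g x) + h x)%:E.
  by rewrite {1}/phi -leeBrDr // -EFinB => /pcc_fin xr; rewrite /phi xr.
have strong x y (r q t : R) : 0 <= t <= 1 ->
    (phi x <= r%:E)%E -> (phi y <= q%:E)%E ->
    (phi (t *: x + (1 - t) *: y)%R <= (t * r + (1 - t) * q
       - t * (1 - t) * edot (x - y) (x - y) / (2 * k))%R%:E)%E.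
  move=> t01; rewrite /phi -!leeBrDr // -!EFinB => xr yq.
  apply: (le_trans (pcc_segment t01 xr yq)); rewrite lee_fin le_eqVlt.
  apply/orP; left; apply/eqP; rewrite /h !edotLR.
  rewrite (edotC y x) (edotC a x) (edotC a y); field.
  by rewrite gt_eqF.
have [x0 gx0] := pcc_dom.
have phi0 : phi x0 = (fine (g x0) + h x0)%:E by rewrite /phi gx0.
set f0 := (X in X%:E) in phi0.
have [|x1 K1 min1] := @compact_min R _ _ phi (@ball_compact R c x0 1) _ phic.
  by exists x0; rewrite /= subrr edot0r.
have x1le : (phi x1 <= f0%:E)%E by rewrite -phi0 min1 //= subrr edot0r.
move: (phi_fin _ _ x1le) => phi1; set b := (X in X%:E) in phi1.
have bf0 : b <= f0 by rewrite -lee_fin -phi1.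
(* Strong convexity on the segment from [x0] to [y], at the point at distance 1
   from [x0], gives [|y - x0| <= rad] whenever [phi y <= phi x0]. *)
pose rad := 1 + 2 * k * (f0 - b).
have rad1 : 1 <= rad by rewrite lerDl mulr_ge0 ?subr_ge0 // mulr_ge0 // ltW.
have [|z Kz minz] := @compact_min R _ _ phi (@ball_compact R c x0 (rad ^+ 2)) _ phic.
  by exists x0; rewrite /= subrr edot0r sqr_ge0.
have zle0 : (phi z <= f0%:E)%E.
  by rewrite -phi0 minz //= subrr edot0r sqr_ge0.
have zmin y : (phi z <= phi y)%E.
  have [Ky|Ky] := leP (edot (y - x0) (y - x0)) (rad ^+ 2); first exact: minz.
  rewrite leNgt; apply/negP => yz.
  have yle : (phi y <= f0%:E)%E by apply: le_trans zle0; exact: ltW.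
  pose t := enorm (y - x0).
  have tsq : edot (y - x0) (y - x0) = t ^+ 2 by rewrite enorm_sqr.
  have t1 : rad < t.
    by by move: Ky; rewrite tsq ltr_pXn2r ?nnegrE ?enorm_ge0 //; lra.
  have t0 : 0 < t by lra.
  have ti01 : 0 <= t^-1 <= 1 by rewrite invr_ge0 ltW //= invf_le1 //; lra.
  have Kp : edot (t^-1 *: y + (1 - t^-1) *: x0 - x0)
                 (t^-1 *: y + (1 - t^-1) *: x0 - x0) <= 1.
    have -> : t^-1 *: y + (1 - t^-1) *: x0 - x0 = t^-1 *: (y - x0).
      by apply/colP => i; rewrite !mxE; ring.
    rewrite edotZl edotZr tsq mulrA -expr2 exprVn mulVf //.
    by rewrite expf_neq0 // gt_eqF.
  have x0le : (phi x0 <= f0%:E)%E by rewrite phi0.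
  have := le_trans (min1 _ Kp) (strong _ _ _ _ _ ti01 yle x0le).
  rewrite phi1 lee_fin tsq.
  rewrite (_ : t^-1 * f0 + _ - _ = f0 - (t - 1) / (2 * k)); last first.
    by field; rewrite !gt_eqF.
  rewrite lerBrDl -lerBrDr ler_pdivrMr ?mulr_gt0 // lerBlDr.
  by apply/negP; rewrite -ltNge addrC mulrC.
exists z => y; case gy: (g y) => [b'| |]; [|by rewrite leey|]; last first.
  by case: pg => -[/(_ y)]; rewrite gy.
move: (phi_fin _ _ zle0) => phiz.
have phiy : (phi y <= (b' + h y)%:E)%E by rewrite /phi gy.
have gz : g z = (fine (g z))%:E.
  by move: zle0; rewrite /phi -leeBrDr // -EFinB => /pcc_fin.
rewrite gz -EFinD lee_fin.
have : fine (g z) + h z <=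
       b' + h y - edot (y - z) (y - z) / (2 * k).
  apply: (@le_of_perturb _ _ _ (edot (y - z) (y - z) / (2 * k))) => t.
  move=> /andP[t0 t1].
  have t01 : 0 <= t <= 1 by rewrite !ltW.
  have zz : (phi z <= (fine (g z) + h z)%:E)%E by rewrite phiz.
  have := le_trans (zmin _) (strong _ _ _ _ _ t01 phiy zz).
  rewrite phiz lee_fin -!mulrA; set E := _ / (2 * k).
  set A := fine (g z) + h z; set B := b' + h y => hh.
  have : 0 <= t * (B - A - (1 - t) * E).
    by move: hh; rewrite -subr_ge0; congr (_ <= _); ring.
  by rewrite pmulr_rge0 //; lra.
rewrite /h !edotLR (edotC z y) (edotC a z) (edotC a y) => hh.
rewrite -subr_ge0 in hh; rewrite -subr_ge0.
move: hh; congr (_ <= _); field; exact: lt0r_neq0.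
Qed.

End ClosedConvex.

(** * Interpolation in the sector class *)

(** The smoothness assumption is that [u] is convex.  Since [q] is a
    subgradient, [u] lies below a parabola touching it at [z]; convexity along
    the segment from [z - t (y - z)] to [y], which passes through [z], turns
    this into the tangent lower bound for [u] at [y] as [t] tends to 0. *)
Lemma descent (R : realType) c (G : 'cV[R]_c -> R) (l : R) (z q y : 'cV[R]_c) :
  let u x := l * quad x - G x in
  0 <= l ->
  (forall x1 x2 t, 0 <= t <= 1 ->
     u (t *: x1 + (1 - t) *: x2) <= t * u x1 + (1 - t) * u x2) ->
  (forall x, G z + edot q (x - z) <= G x) ->
  G y <= G z + edot q (y - z) + l * quad (y - z).
Proof.
move=> u l0 cu qz.
apply: (@le_of_perturb _ _ _ (l * quad (y - z))) => t /andP[t0 t1].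
pose r := t / (1 + t); pose x := z - t *: (y - z).
have r01 : 0 <= r <= 1.
  by rewrite /r divr_ge0 ?ler_pdivrMr /=; lra.
have zE : r *: y + (1 - r) *: x = z.
  by apply/colP => i; rewrite /r /x !mxE; field; lra.
have := cu y x r r01; rewrite zE => hu.
have {hu} : (1 + t) * u z <= t * u y + u x.
  have -> : t * u y + u x = (1 + t) * (r * u y + (1 - r) * u x).
    by rewrite /r; field; lra.
  by rewrite ler_pM2l //; lra.
have := qz x; rewrite /u /x => hx hu.
have {hx hu} : 0 <= t * (G z + edot q (y - z) + l * quad (y - z)
   + t * (l * quad (y - z)) - G y).
  rewrite (_ : t * _ = (t * (l * quad y - G y) +
     (l * quad (z - t *: (y - z)) - (G z + edot q (z - t *: (y - z) - z))))
     - (1 + t) * (l * quad z - G z)); first by lra.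
  by rewrite !quadE !edotLR (edotC z y); field.
by rewrite pmulr_rge0 // subr_ge0.
Qed.

Section SectorClass.
Variables (R : realType) (c : nat) (m : R) (L : \bar R) (f : 'cV[R]_c -> \bar R).
Hypotheses (Sf : classS m L f) (mL : (m%:E < L)%E).

Let g y := (f y - (m * quad y)%:E)%E.
Let sigma := sector_width_inv m L.

Lemma sector_width_inv_ge0 : 0 <= sigma.
Proof.
rewrite /sigma; case: L mL => [l| |] //=; rewrite lte_fin => ml.
by rewrite invr_ge0 subr_ge0 ltW.
Qed.

(** For a finite upper bound the inequality is the subgradient inequality at
    [z], evaluated at the point where the upper parabola of [g] at [z'], with
    slope corrected by [q], is minimal. *)
Lemma sector_interpolation z q z' q' :
  convex_subdiff g z q -> convex_subdiff g z' q' ->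
  fine (g z) + edot q (z' - z) + sigma / 2 * edot (q' - q) (q' - q)
    <= fine (g z').
Proof.
case: Sf => pg pu gz gz'.
have gzf := subdiff_fin pg gz; have gzf' := subdiff_fin pg gz'.
have basic : fine (g z) + edot q (z' - z) <= fine (g z').
  by rewrite -lee_fin EFinD -gzf -gzf'; exact: gz.
move: pu mL; rewrite /sigma; case: L => [l| |] //= pu; last first.
  by move=> _; rewrite !mul0r addr0.
rewrite lte_fin => ml; have {}pu := pu l erefl.
have ffin x : f x = (fine (f x))%:E.
  apply/esym/fineK; rewrite fin_numE.
  case: pg pu => -[/(_ x) h1 _] _ _ [[/(_ x) h2 _] _ _].
  by move: h1 h2; rewrite /g; case: (f x).
pose G x := fine (f x) - m * quad x.
have gE x : g x = (G x)%:E by rewrite /g ffin.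
have cu x1 x2 t : 0 <= t <= 1 ->
    (l - m) * quad (t *: x1 + (1 - t) *: x2) - G (t *: x1 + (1 - t) *: x2)
    <= t * ((l - m) * quad x1 - G x1) + (1 - t) * ((l - m) * quad x2 - G x2).
  move=> t01.
  have uE x : (l - m) * quad x - G x = l * quad x - fine (f x).
    by rewrite /G; ring.
  rewrite !uE -lee_fin EFinB -ffin; apply: (pcc_segment pu t01);
    by rewrite ffin.
have gzG x : G z + edot q (x - z) <= G x.
  by rewrite -lee_fin EFinD -!gE; exact: gz.
have gzG' x : G z' + edot q' (x - z') <= G x.
  by rewrite -lee_fin EFinD -!gE; exact: gz'.
have lm0 : 0 < l - m by rewrite subr_gt0.
pose y := z' - (l - m)^-1 *: (q' - q).
have := le_trans (gzG y) (@descent R c G (l - m) z' q' y (ltW lm0) cu gzG').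
rewrite !gE /= -subr_ge0 => h; rewrite -subr_ge0; move: h.
congr (_ <= _); rewrite /y quadE !edotLR (edotC q' q); field.
by rewrite gt_eqF.
Qed.

(** With [p = z - sigma q] the interpolation inequality is the subgradient
    inequality of a convex function at [p], whose value there is
    [sector_value z q]: the sector bound has been removed by loop shifting. *)
Definition sector_value (z q : 'cV[R]_c) : R :=
  fine (g z) - sigma / 2 * edot q q.

Lemma sector_value_le z q z' q' :
  convex_subdiff g z q -> convex_subdiff g z' q' ->
  sector_value z q + edot q ((z' - sigma *: q') - (z - sigma *: q))
    <= sector_value z' q'.
Proof.
move=> gz gz'; have := sector_interpolation gz gz'; rewrite /sector_value.
rewrite -subr_ge0 => h; rewrite -subr_ge0; move: h; congr (_ <= _).
by rewrite !edotLR (edotC q' q); field.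
Qed.

Lemma sector_prox (k : R) (a : 'cV[R]_c) : 0 < k ->
  exists z q, convex_subdiff g z q /\ z + k *: q = a.
Proof.
case: Sf => pg _ k0; have [z gz] := pcc_prox pg a k0.
exists z, (k^-1 *: (a - z)); split => //.
by rewrite scalerA divff ?gt_eqF // scale1r addrC subrK.
Qed.

End SectorClass.

(** * Block vectors *)

Section Blocks.
Variables (R : realType) (s c : nat).
Implicit Types (x y : 'cV[R]_(s * c)) (i : 'I_s).

Lemma blkP x y : (forall i, blk i x = blk i y) -> x = y.
Proof.
move=> h; apply/colP => k; case: (mxtens_indexP k) => i j.
by have /colP/(_ j) := h i; rewrite !mxE.
Qed.

Definition stack (f : 'I_s -> 'cV[R]_c) : 'cV[R]_(s * c) :=
  \col_k f (mxtens_unindex k).1 (mxtens_unindex k).2 0.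

Lemma blk_stack f i : blk i (stack f) = f i.
Proof. by apply/colP => j; rewrite !mxE mxtens_indexK. Qed.

Lemma blkD i x y : blk i (x + y) = blk i x + blk i y.
Proof. by apply/colP => j; rewrite !mxE. Qed.

Lemma blkN i x : blk i (- x) = - blk i x.
Proof. by apply/colP => j; rewrite !mxE. Qed.

Lemma blkB i x y : blk i (x - y) = blk i x - blk i y.
Proof. by rewrite blkD blkN. Qed.

Lemma blkZ i a x : blk i (a *: x) = a *: blk i x.
Proof. by apply/colP => j; rewrite !mxE. Qed.

Lemma sum_mxtens_index (V : nmodType) (F : 'I_(s * c) -> V) :
  \sum_k F k = \sum_i \sum_j F (mxtens_index (i, j)).
Proof.
rewrite pair_big /=.
rewrite (reindex (@mxtens_index s c)) /=; first by apply: eq_bigr => -[].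
exists (@mxtens_unindex s c) => k _; [exact: mxtens_indexK|exact: mxtens_unindexK].
Qed.

Lemma edot_blk x y : edot x y = \sum_i edot (blk i x) (blk i y).
Proof.
rewrite /edot sum_mxtens_index; apply: eq_bigr => i _.
by apply: eq_bigr => j _; rewrite !mxE.
Qed.

Lemma blk_diag_kron i (d : 'I_s -> R) x :
  blk i (diag_kron c d *m x) = d i *: blk i x.
Proof.
apply/colP => j; rewrite !mxE sum_mxtens_index.
rewrite (bigD1 i) //= [X in _ + X]big1 ?addr0 => [|i' ne]; last first.
  apply: big1 => j' _; rewrite /diag_kron tensmxE !mxE.
  by rewrite eq_sym (negPf ne) mulr0n !mul0r.
rewrite (bigD1 j) //= [X in _ + X]big1 ?addr0 => [|j' ne].
  by rewrite /diag_kron tensmxE !mxE !eqxx mulr1n mulr1.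
by rewrite /diag_kron tensmxE !mxE [j == j']eq_sym (negPf ne) mulr0n mulr0 mul0r.
Qed.

Lemma ones_kronE k j :
  ones_kron R s c k j = ((mxtens_unindex k).2 == j)%:R.
Proof.
case: (mxtens_indexP k) => i j'; rewrite /ones_kron castmxE.
rewrite mxtens_indexK /=.
rewrite (_ : cast_ord _ j = mxtens_index (ord0 : 'I_1, j)); last first.
  by apply: val_inj => /=; rewrite mul0n.
by rewrite cast_ord_id tensmxE !mxE mul1r.
Qed.

Lemma blk_ones_kron i (b : 'cV[R]_c) : blk i (ones_kron R s c *m b) = b.
Proof.
apply/colP => j; rewrite !mxE (bigD1 j) //= big1 ?addr0 => [|j' ne].
  by rewrite ones_kronE mxtens_indexK /= eqxx mul1r.
by rewrite ones_kronE mxtens_indexK /= eq_sym (negPf ne) mul0r.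
Qed.

Lemma tr_ones_kron_mul x : (ones_kron R s c)^T *m x = \sum_i blk i x.
Proof.
apply/colP => j; rewrite mxE sum_mxtens_index summxE; apply: eq_bigr => i _.
rewrite (bigD1 j) //= big1 ?addr0 => [|j' ne].
  by rewrite mxE ones_kronE mxtens_indexK /= eqxx mul1r mxE.
by rewrite mxE ones_kronE mxtens_indexK /= (negPf ne) mul0r.
Qed.

End Blocks.

(** * Operators of the class *)

Section Operators.
Variables (R : realType) (s c : nat) (m : 'I_s -> R) (L : 'I_s -> \bar R).
Hypothesis mL : forall i, ((m i)%:E < L i)%E.
Variable F : operator R (s * c).
Hypothesis OF : classO m L F.

Let mm := diag_kron c m.
Let sigma := diag_kron c (fun i => sector_width_inv (m i) (L i)).

(** The signals of the filtered interconnection: the sector [m, L] of the operator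
    from [z] to [w] becomes monotonicity of the relation between [shift_p] and
    [shift_q]. *)
Definition shift_q (z w : 'cV[R]_(s * c)) := w - mm *m z.
Definition shift_p (z w : 'cV[R]_(s * c)) := z - sigma *m shift_q z w.

(** A common potential on the graph of [F] in each block; this is stronger than
    monotonicity and is what allows signals at different times to be compared in
    the Zames-Falb inequality. *)
Lemma classO_potential : exists V : 'I_s -> 'cV[R]_(s * c) -> 'cV[R]_(s * c) -> R,
  forall i z w z' w', F z w -> F z' w' ->
  V i z w + edot (blk i (shift_q z w)) (blk i (shift_p z' w' - shift_p z w))
    <= V i z' w'.
Proof.
case: OF => f [Sf Fz _].
exists (fun i z w => sector_value (m i) (L i) (f i) (blk i z)
                       (blk i (shift_q z w))).
have qE i z w : F z w ->
    convex_subdiff (fun y => f i y - (m i * quad y)%:E)%E (blk i z)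
                   (blk i (shift_q z w)).
  rewrite Fz => /(_ i) [v hv vE].
  by rewrite blkB blk_diag_kron -vE addrK.
move=> i z w z' w' zw zw'; rewrite blkB !(blkB _ z) !(blkB _ z').
rewrite !blk_diag_kron.
exact (sector_value_le (Sf i) (mL i) (qE i _ _ zw) (qE i _ _ zw')).
Qed.

Lemma classO_prox (k : 'I_s -> R) (a : 'cV[R]_(s * c)) : (forall i, 0 < k i) ->
  exists z w, F z w /\ z + diag_kron c k *m shift_q z w = a.
Proof.
case: OF => f [Sf Fz _] k0.
have h i : exists zq : 'cV[R]_c * 'cV[R]_c,
    convex_subdiff (fun y => f i y - (m i * quad y)%:E)%E zq.1 zq.2 /\
    zq.1 + k i *: zq.2 = blk i a.
  have [z [q]] := sector_prox (Sf i) (blk i a) (k0 i).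
  by exists (z, q).
have [zq hzq] := choice h.
pose z := stack (fun i => (zq i).1).
pose q := stack (fun i => (zq i).2).
exists z, (q + mm *m z); split.
  rewrite Fz => i; exists (blk i q); first by rewrite !blk_stack; case: (hzq i).
  by rewrite blkD blk_diag_kron.
apply: blkP => i; rewrite /shift_q addrK blkD blk_diag_kron !blk_stack.
by case: (hzq i).
Qed.

Lemma classO_optimum : exists b w,
  (ones_kron R s c)^T *m w = 0 /\ F (ones_kron R s c *m b) w.
Proof.
case: OF => f [_ Fz [[b w] [[/= w0 bw] _]]]; exists b, w.
rewrite tr_ones_kron_mul; split => //; rewrite Fz => i.
by rewrite blk_ones_kron.
Qed.

End Operators.

(** * Well-posedness of the algebraic loop *)

Lemma ler_enormD (R : realType) n (u v : 'cV[R]_n) :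
  enorm (u + v) <= enorm u + enorm v.
Proof.
apply: enorm_le; first by rewrite addr_ge0 ?enorm_ge0.
have := enorm_CauchySchwarz u v.
by rewrite sqrrD !enorm_sqr !edotLR (edotC v u); lra.
Qed.

Lemma edot_lipschitz_continuous (R : realType) n p
    (f : 'cV[R]_n -> 'cV[R]_p) (K : R) : 0 <= K ->
  (forall x y, edot (f x - f y) (f x - f y) <= K * edot (x - y) (x - y)) ->
  continuous f.
Proof.
move=> K0 hf x; pose C := Num.sqrt (K * n%:R) + 1.
have C0 : 0 < C by rewrite ltr_wpDl // sqrtr_ge0.
have lip y : `|f x - f y| <= C * `|x - y|.
  apply: (le_trans (norm_le_enorm _)).
  apply: (@le_trans _ _ (Num.sqrt (K * n%:R) * `|x - y|)); last first.
    by rewrite ler_wpM2r // lerDl.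
  apply: enorm_le; first by rewrite mulr_ge0 // sqrtr_ge0.
  rewrite exprMn sqr_sqrtr ?mulr_ge0 // -mulrA.
  by apply: (le_trans (hf _ _)); rewrite ler_wpM2l // edot_le_norm.
move=> S /= /(nbhs_ballP (f x)) [e /= e0 es].
apply/nbhs_ballP; exists (e / C) => /= [|y]; first by rewrite divr_gt0.
rewrite -ball_normE /= => xy; apply: es; rewrite -ball_normE /=.
by apply: (le_lt_trans (lip y)); rewrite mulrC -ltr_pdivlMr.
Qed.

(** In finite dimension a contraction has a fixed point because the
    displacement [|f x - x|] attains its minimum on a ball that [f] maps into
    itself, and applying [f] to a minimizer would decrease it unless it is 0. *)
Lemma edot_contraction_fixpoint (R : realType) n (f : 'cV[R]_n -> 'cV[R]_n)
    (k : R) : 0 <= k < 1 ->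
  (forall x y, edot (f x - f y) (f x - f y) <= k * edot (x - y) (x - y)) ->
  exists x, f x = x.
Proof.
move=> /andP[k0 k1] hf; pose th := Num.sqrt k.
have th0 : 0 <= th by exact: sqrtr_ge0.
have th1 : th < 1 by rewrite -sqrtr1 ltr_sqrt.
have lip x y : enorm (f x - f y) <= th * enorm (x - y).
  apply: enorm_le; first by rewrite mulr_ge0 // enorm_ge0.
  by rewrite exprMn sqr_sqrtr // enorm_sqr.
have fc := edot_lipschitz_continuous k0 hf.
pose r := enorm (f 0) / (1 - th).
have r0 : 0 <= r by rewrite divr_ge0 ?enorm_ge0 // subr_ge0 ltW.
have inK (x : 'cV[R]_n) : edot (x - 0) (x - 0) <= r ^+ 2 <-> enorm x <= r.
  rewrite subr0 -enorm_sqr; split=> h; last first.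
    by rewrite lerXn2r ?nnegrE ?enorm_ge0.
  by move: h; rewrite ler_pXn2r ?nnegrE ?enorm_ge0.
pose phi x := (edot (f x - x - 0) (f x - x - 0))%:E.
have phic (e : R) : closed [set x | (phi x <= e%:E)%E].
  pose d (x : 'cV[R]_n) := edot (f x - x - 0) (f x - x - 0).
  apply: (@preimage_closed _ _ d [set t | t <= e]) (@closed_le _ e) => x _.
  apply: (@continuous_comp _ _ _ (fun y => f y - y)
    (fun v : 'cV[R]_n => edot (v - 0) (v - 0))).
    by apply: (@continuousB _ _ _ f id); [exact: fc|move=> B; exact].
  exact: edot_dist_continuous.
have [|x /inK Kx minx] :=
    @compact_min R _ _ phi (@ball_compact R n 0 (r ^+ 2)) _ phic.
  by exists 0; apply/inK; rewrite /enorm edot0r sqrtr0.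
exists x; have Kfx : enorm (f x) <= r.
  rewrite -(subrK (f 0) (f x)) (le_trans (ler_enormD _ _)) //.
  have := lip x 0; rewrite subr0 => h.
  have rE : enorm (f 0) = (1 - th) * r.
    by rewrite mulrC divfK // gt_eqF // subr_gt0.
  have h2 : th * enorm x <= th * r by rewrite ler_wpM2l.
  by rewrite rE; lra.
have := minx (f x) ((inK _).2 Kfx); rewrite /phi lee_fin !subr0.
move=> /le_trans/(_ (hf _ _)) h; apply/eqP; rewrite -subr_eq0 -edot_eq0.
rewrite eq_le edot_ge0 andbT -(@pmulr_rle0 _ (1 - k)) ?subr_gt0 //.
by rewrite mulrBl mul1r subr_le0.
Qed.

Section AlgebraicLoop.
Variables (R : realType) (s c : nat) (m : 'I_s -> R) (L : 'I_s -> \bar R).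
Hypothesis mL : forall i, ((m i)%:E < L i)%E.
Variable F : operator R (s * c).
Hypothesis OF : classO m L F.
Variables (D : 'M[R]_(s * c)) (lam0 : 'I_s -> R).

Let mm := diag_kron c m.
Let sigma := diag_kron c (fun i => sector_width_inv (m i) (L i)).
Let H := invmx (1%:M - mm *m D).
Let Ds := D *m H - sigma.
Let Lam := diag_kron c lam0.

Hypothesis unitD : 1%:M - mm *m D \in unitmx.
Hypothesis lam0_gt0 : forall i, 0 < lam0 i.
Hypothesis Ds_neg : negdef (Lam *m Ds).

Local Notation q := (shift_q m).
Local Notation p := (shift_p m L).

Lemma shift_monotone z w z' w' : F z w -> F z' w' ->
  0 <= edot (q z w - q z' w') (Lam *m (p z w - p z' w')).
Proof.
move=> zw zw'; have [V hV] := classO_potential mL OF.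
rewrite edot_blk; apply: sumr_ge0 => i _.
rewrite blk_diag_kron edotZr mulr_ge0 ?(ltW (lam0_gt0 i)) //.
have := hV i _ _ _ _ zw zw'; have := hV i _ _ _ _ zw' zw.
by rewrite !blkB !edotLR; lra.
Qed.

Lemma loop_w z w : w = H *m (q z w + mm *m (z - D *m w)).
Proof.
have -> : q z w + mm *m (z - D *m w) = (1%:M - mm *m D) *m w.
  by rewrite /shift_q mulmxBl mul1mx (mulmxBr mm) mulmxA addrA subrK.
by rewrite mulKmx.
Qed.

(** Eliminating [z] and [w] in favour of [p] and [q] leaves only the input
    [z - D w] of the loop on the right-hand side. *)
Lemma loop_p z w :
  Lam *m p z w - Lam *m Ds *m q z w
    = Lam *m (1%:M + D *m H *m mm) *m (z - D *m w).
Proof.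
rewrite -(mulmxA Lam Ds) -(mulmxA Lam (1%:M + _)) -mulmxBr; congr (_ *m _).
have zE : z - D *m w + D *m w = z by rewrite subrK.
have DwE : D *m w = D *m H *m q z w + D *m H *m mm *m (z - D *m w).
  by rewrite {1}(loop_w z w) !mulmxDr !mulmxA.
rewrite {1}/shift_p -/mm -/sigma /Ds mulmxBl mulmxDl mul1mx.
rewrite -{1}zE {2}DwE; set a := D *m H *m _; set b := sigma *m _.
set d := _ *m (z - _); apply/colP => i; rewrite !mxE; ring.
Qed.

(** Along the loop the shifted output solves a strongly monotone equation: the
    monotone part [Lam p] plus the coercive linear part.  Testing the difference
    of two such equations with the difference of the [q]'s bounds it by the
    difference of the right-hand sides. *)
Lemma loop_lipschitz : exists2 K : R, 0 <= K &
  forall z1 w1 z2 w2, F z1 w1 -> F z2 w2 ->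
    edot (w1 - w2) (w1 - w2) <=
    K * edot (z1 - D *m w1 - (z2 - D *m w2)) (z1 - D *m w1 - (z2 - D *m w2)).
Proof.
have [e e0 he] := negdef_coercive Ds_neg.
set B := Lam *m (1%:M + D *m H *m mm).
have [KB KB0 hB] := mulmx_bounded B.
have [KH KH0 hH] := mulmx_bounded H.
have [Km Km0 hm] := mulmx_bounded mm.
exists (KH * (2 * (KB / e ^+ 2) + 2 * Km)).
  have := divr_gt0 KB0 (exprn_gt0 2 e0) => h.
  by rewrite mulr_ge0 ?ltW // addr_gt0 // mulr_gt0.
move=> z1 w1 z2 w2 zw1 zw2.
set dv := z1 - D *m w1 - (z2 - D *m w2); set dq := q z1 w1 - q z2 w2.
set dp := p z1 w1 - p z2 w2.
have dE : Lam *m dp - Lam *m Ds *m dq = B *m dv.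
  rewrite /dp /dq /dv (mulmxBr B) -(loop_p z1 w1) -(loop_p z2 w2).
  rewrite (mulmxBr Lam) (mulmxBr (Lam *m Ds)) !opprD !opprK -!addrA.
  by congr (_ + _); rewrite addrCA.
have mono : 0 <= edot dq (Lam *m dp) := shift_monotone zw1 zw2.
have dwE : w1 - w2 = H *m (dq + mm *m dv).
  rewrite {1}(loop_w z1 w1) {1}(loop_w z2 w2) -mulmxBr /dq /dv.
  by congr (_ *m _); rewrite (mulmxBr mm (z1 - _)) opprD addrACA.
clearbody dv dq dp.
have dq_le : edot dq dq <= KB / e ^+ 2 * edot dv dv.
  have h1 : e * edot dq dq <= edot dq (B *m dv).
    by rewrite -dE edotBr; have := he dq; lra.
  have h2 := edot_ge0 (e *: dq - B *m dv).
  have h3 := hB dv.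
  rewrite mulrAC ler_pdivlMr ?exprn_gt0 //.
  move: h2; rewrite !edotLR (edotC (B *m dv) dq) => h2.
  have h4 : e * (e * edot dq dq) <= e * edot dq (B *m dv).
    by rewrite ler_wpM2l // ltW.
  by rewrite expr2; lra.
rewrite dwE; apply: (le_trans (hH _)); rewrite -mulrA ler_wpM2l //; first exact: ltW.
apply: (le_trans (edot_triangle _ _)); by have := hm dv; lra.
Qed.

(** Existence is a fixed point of a forward-backward step with step size [1/W].
    The forward part is linear; the backward part inverts [Lam p + W q], which
    is a proximal step in each block since [W / lam0 i] exceeds the sector
    shift.  Large [W] makes the step a contraction. *)
Lemma loop_solvable v : exists z w, F z w /\ z - D *m w = v.
Proof.
pose T := - (Lam *m Ds).
have [e e0 he] := negdef_coercive Ds_neg.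
have Te u : e * edot u u <= edot u (T *m u).
  by have := he u; rewrite mulNmx edotNr; lra.
have [K K0 hK] := mulmx_bounded T.
pose sg i := sector_width_inv (m i) (L i).
have sg0 i : 0 <= sg i by exact: sector_width_inv_ge0 (mL i).
pose S := \sum_i lam0 i * sg i.
have S0 : 0 <= S by apply: sumr_ge0 => i _; rewrite mulr_ge0 // ltW.
pose W := K / e + e + S + 1.
have Ke0 : 0 < K / e by rewrite divr_gt0.
have W0 : 0 < W by rewrite /W; lra.
have k0 i : 0 < W / lam0 i - sg i.
  rewrite subr_gt0 ltr_pdivlMr // mulrC.
  apply: (@le_lt_trans _ _ S); last by rewrite /W; lra.
  rewrite /S (bigD1 i) //= lerDl.
  by apply: sumr_ge0 => j _; rewrite mulr_ge0 // ltW.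
pose b := Lam *m (1%:M + D *m H *m mm) *m v.
pose Li := diag_kron c (fun i => (lam0 i)^-1).
have LamLi (x : 'cV[R]_(s * c)) : Lam *m (Li *m x) = x.
  by apply: blkP => i; rewrite !blk_diag_kron scalerA divff ?scale1r // gt_eqF.
have LiLam (x : 'cV[R]_(s * c)) : Li *m (Lam *m x) = x.
  by apply: blkP => i; rewrite !blk_diag_kron scalerA mulVf ?scale1r // gt_eqF.
have step (u : 'cV[R]_(s * c)) : exists zw : 'cV[R]_(s * c) * 'cV[R]_(s * c),
    F zw.1 zw.2 /\
    Lam *m p zw.1 zw.2 + W *: q zw.1 zw.2 = b - T *m u + W *: u.
  have [z [w [zw zwE]]] := classO_prox OF (Li *m (b - T *m u + W *: u)) k0.
  exists (z, w); split => //=; rewrite -[RHS]LamLi -zwE.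
  apply: blkP => i; rewrite /shift_p.
  rewrite !(blkD, blkN, blkZ, blk_diag_kron) -/(sg i).
  apply/colP => j; rewrite !mxE; field.
  by rewrite gt_eqF.
have [zw hzw] := choice step.
pose f u := q (zw u).1 (zw u).2.
have th01 : 0 <= 1 - e / W < 1.
  rewrite subr_ge0 ler_pdivrMr // mul1r gtrBl divr_gt0 // andbT /W; lra.
have fcontr x y : edot (f x - f y) (f x - f y) <= (1 - e / W) * edot (x - y) (x - y).
  have [Fx Ex] := hzw x; have [Fy Ey] := hzw y.
  set dq := f x - f y; set du := x - y.
  set dp := p (zw x).1 (zw x).2 - p (zw y).1 (zw y).2.
  have mono : 0 <= edot dq (Lam *m dp) := shift_monotone Fx Fy.
  have dE : W *: du - T *m du = Lam *m dp + W *: dq.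
    rewrite /dp /dq (mulmxBr Lam) (scalerBr W (f x)) addrACA -opprD.
    rewrite /f Ex Ey /du (mulmxBr T); set a1 := T *m x; set a2 := T *m y.
    by apply/colP => i; rewrite !mxE; ring.
  clearbody dq du dp.
  have h1 : W * edot dq dq <= edot dq (W *: du - T *m du).
    by rewrite dE edotDr edotZr; lra.
  have h2 := edot_ge0 (W *: dq - (W *: du - T *m du)).
  have h3 : edot (W *: du - T *m du) (W *: du - T *m du)
            <= W ^+ 2 * ((1 - e / W) * edot du du).
    have -> : W ^+ 2 * ((1 - e / W) * edot du du)
       = (W ^+ 2 - W * e) * edot du du by field; rewrite gt_eqF.
    have := hK du; have := Te du; rewrite !edotLR (edotC (T *m du) du).
    set A := edot du du; set X := edot du (T *m du) => hA hX.
    have A0 : 0 <= A by exact: edot_ge0.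
    have KA : K * A <= W * (e * A).
      rewrite mulrA ler_wpM2r // -ler_pdivrMr // /W; lra.
    have WX : W * (e * A) <= W * X by rewrite ler_wpM2l // ltW.
    by rewrite expr2; lra.
  rewrite -(ler_pM2l (exprn_gt0 2 W0)); apply: le_trans h3.
  have h4 : W * (W * edot dq dq) <= W * edot dq (W *: du - T *m du).
    by rewrite ler_wpM2l // ltW.
  move: h1 h2 h4; move: (W *: du - T *m du) => r h1.
  by rewrite !edotLR (edotC r dq) expr2; lra.
have [u fu] := edot_contraction_fixpoint th01 fcontr.
have [Fu Eu] := hzw u.
move: Fu Eu fu; rewrite /f; case: (zw u) => z w /= Fu Eu fu.
(* The fixed point gives [d + D H mm d = 0]; multiplying [H mm d] by [I - mm D]
   then shows [H mm d = 0]. *)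
exists z, w; split=> //; pose d := z - D *m w - v.
have {}Eu : Lam *m p z w - Lam *m Ds *m q z w = b.
  apply: (addIr (W *: u)); move: Eu; rewrite fu => E.
  by rewrite addrAC E /T mulNmx opprK addrAC addrK.
have dE : d + D *m (H *m (mm *m d)) = 0.
  have /(congr1 (mulmx Li)) : Lam *m ((1%:M + D *m H *m mm) *m d) = 0.
    by rewrite /d mulmxBr mulmxBr !mulmxA -/b -Eu loop_p subrr.
  by rewrite LiLam mulmx0 mulmxDl mul1mx !mulmxA.
have y0 : H *m (mm *m d) = 0.
  have : (1%:M - mm *m D) *m (H *m (mm *m d)) = mm *m d by rewrite mulKVmx.
  rewrite mulmxBl mul1mx => /eqP; rewrite subr_eq -mulmxA -mulmxDr dE mulmx0.
  by move/eqP.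
by move: dE; rewrite y0 mulmx0 addr0 => /eqP; rewrite subr_eq0 => /eqP.
Qed.

Lemma classO_loop_continuous :
  globally_continuous (op_inv (op_sub_mx (op_inv F) D)).
Proof.
have [K K0 hK] := loop_lipschitz.
have sol v : exists w, exists2 z, F z w & z - D *m w = v.
  by have [z [w [zw E]]] := loop_solvable v; exists w, z.
have [g hg] := choice sol; exists g.
  apply: (edot_lipschitz_continuous K0) => x y.
  have [zx Fx Ex] := hg x; have [zy Fy Ey] := hg y.
  by have := hK _ _ _ _ Fx Fy; rewrite Ex Ey.
move=> v; have [z zF Ez] := hg v; apply/seteqP; split=> [w [z' Fz' Ez']|_ ->].
  have := hK _ _ _ _ zF Fz'; rewrite Ez Ez' subrr edot0r mulr0 => h.
  apply/esym/eqP; rewrite -subr_eq0 -edot_eq0 eq_le edot_ge0.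
  by rewrite h.
by exists z.
Qed.

End AlgebraicLoop.

(** * Dissipation inequality *)

Section Dissipation.
Variables (R : realType) (n p : nat) (G : lti R n p p) (M : 'M[R]_n).

Lemma passivity_lmi_dissipation : passivity_lmi G M ->
  exists2 e : R, 0 < e & forall x u x1, x1 = sA G *m x + sB G *m u ->
    edot x1 (M *m x1) - edot x (M *m x) + edot (sC G *m x + sD G *m u) u
      <= - (e * (edot x x + edot u u)).
Proof.
move=> /negdef_coercive [e e0 he]; exists e; first exact: e0.
move=> x u x1 x1E.
have := he (col_mx x u).
rewrite mulmxDl edotDr -scalemxAl edotZr -!mulmxA !(edot_mulmxr _^T) !trmxK.
rewrite !mul_block_col !mul1mx !mul0mx !addr0 !add0r -x1E.
rewrite !edot_col_mx mulNmx edotNr (edotC u).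
by set Y := edot (_ + _) u; lra.
Qed.

(** Telescoping of the dissipation inequality: a nonnegative accumulated supply
    leaves only the initial storage to feed the quadratic terms. *)
Lemma passivity_lmi_bounded : posdef M -> passivity_lmi G M ->
  exists2 C : R, 0 <= C & forall (x : nat -> 'cV[R]_n) (u : nat -> 'cV[R]_p),
    (forall k, x k.+1 = sA G *m x k + sB G *m u k) ->
    (forall T, 0 <= \sum_(k < T) edot (sC G *m x k + sD G *m u k) (u k)) ->
    forall k, edot (x k) (x k) + edot (u k) (u k) <= C * edot (x 0%N) (x 0%N).
Proof.
move=> Mp /passivity_lmi_dissipation [e e0 he].
have [K K0 hK] := mulmx_bounded M.
have M0 v : 0 <= edot v (M *m v).
  have [->|/Mp/ltW//] := eqVneq v 0; by rewrite edot0l.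
exists ((1 + K) / e) => [|x u xS supply k].
  by rewrite divr_ge0 ?ltW // addr_gt0.
pose V k := edot (x k) (M *m x k).
pose S T := \sum_(k < T) edot (sC G *m x k + sD G *m u k) (u k).
pose E k := edot (x k) (x k) + edot (u k) (u k).
have E0 j : 0 <= E j by rewrite addr_ge0 ?edot_ge0.
have tele T : V T + S T + e * \sum_(k < T) E k <= V 0%N.
  elim: T => [|T IH]; first by rewrite /S !big_ord0 mulr0 !addr0.
  rewrite /S !big_ord_recr /= -/(S T).
  have := he _ _ _ (xS T); rewrite -/(V T) -/(V T.+1) -/(E T).
  by set Y := edot (_ + _) _; lra.
have Ek : E k <= \sum_(j < k.+1) E j.
  by rewrite big_ord_recr /= lerDr; apply: sumr_ge0.
have := tele k.+1; have := supply k.+1; rewrite -/(S _) => hS hV.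
have V1 : 0 <= V k.+1 by exact: M0.
rewrite mulrAC ler_pdivlMr // -/(E k).
have {}Ek : e * E k <= e * \sum_(j < k.+1) E j by rewrite ler_wpM2l // ltW.
have V0 : V 0%N <= (1 + K) * edot (x 0%N) (x 0%N).
  rewrite /V; have := hK (x 0%N); have := edot_ge0 (x 0%N - M *m x 0%N).
  rewrite !edotLR (edotC (M *m _) (x 0%N)).
  have := edot_ge0 (x 0%N); have := edot_ge0 (M *m x 0%N).
  have := M0 (x 0%N); nra.
by rewrite mulrC; lra.
Qed.

End Dissipation.

(** * The filter and its multiplier inequality *)

Definition delay (V : nmodType) (f : nat -> V) (v k : nat) : V :=
  if (v <= k)%N then f (k - v)%N else 0.

Lemma delaySS (V : nmodType) (f : nat -> V) v k :
  delay f v.+1 k.+1 = delay f v k.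
Proof. by rewrite /delay ltnS subSS. Qed.

Lemma sum_delay_le (R : realDomainType) (f : nat -> R) v T :
  (forall k, 0 <= f k) -> \sum_(k < T) delay f v k <= \sum_(k < T) f k.
Proof.
move=> f0; elim: v T => [|v IH] T.
  by apply: ler_sum => k _; rewrite /delay leq0n subn0.
case: T => [|T]; first by rewrite !big_ord0.
rewrite big_ord_recl /= {1}/delay ltn0 add0r big_ord_recr /= ler_wpDr //.
by under eq_bigr do rewrite /bump /= add1n delaySS; exact: IH.
Qed.

(** The discrete Zames-Falb inequality for exponentially weighted signals.
    The [h k] are values of a convex potential along [pp], with gradients [qq],
    which vanishes together with its gradient at 0.  Each tap [v] contributes
    at least a multiple of the excess [<q, p> - h] and a multiple of the delayed
    weighted potential; the weights [rho ^ v] and [rho ^ -v] arise since the two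
    signals of the product are weighted at different times.  Summation over time
    moves all delays to the same potential. *)
Lemma zames_falb (R : realType) c (rho : R) (numax T : nat)
    (lam : 'I_numax.+1 -> R) (pp qq : nat -> 'cV[R]_c) (h : nat -> R) :
  0 < rho < 1 ->
  0 < \sum_(v < numax.+1) rho ^- v * lam v ->
  (forall v : 'I_numax.+1, (1 <= v)%N -> lam v <= 0) ->
  (forall k, 0 <= h k <= edot (qq k) (pp k)) ->
  (forall k j, h k + edot (qq k) (pp j - pp k) <= h j) ->
  0 <= \sum_(k < T) \sum_(v < numax.+1)
    lam v * edot (delay (fun j => rho ^- j *: pp j) v k) (rho ^- k *: qq k).
Proof.
move=> /andP[r0 r1] lam_pos lam_neg h0 hj.
have rn0 k : rho ^+ k != 0 by rewrite expf_neq0 // gt_eqF.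
have rV0 k : 0 < rho ^- k by rewrite invr_gt0 exprn_gt0.
pose hb k := rho ^- k * rho ^- k * h k.
have hb0 k : 0 <= hb k by rewrite !mulr_ge0 ?(ltW (rV0 _)) //; case/andP: (h0 k).
pose g k := rho ^- k * rho ^- k * edot (qq k) (pp k) - hb k.
have g0 k : 0 <= g k.
  rewrite /g /hb -mulrBr !mulr_ge0 ?(ltW (rV0 _)) // subr_ge0.
  by case/andP: (h0 k).
have tap_le k v : (1 <= v)%N ->
    edot (delay (fun j => rho ^- j *: pp j) v k) (rho ^- k *: qq k)
      <= rho ^+ v * g k + rho ^- v * delay hb v k.
  move=> v1; rewrite /delay; case: leqP => vk; last first.
    by rewrite edot0l mulr0 addr0 mulr_ge0 // exprn_ge0 // ltW.
  have [j ->] : exists j, k = (j + v)%N by exists (k - v)%N; rewrite subnK.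
  rewrite addnK edotZl edotZr /g /hb exprD.
  rewrite [leRHS](_ : _ = rho ^- j * rho ^- j * rho ^- v *
      (edot (qq (j + v)%N) (pp (j + v)%N) - h (j + v)%N + h j)); last first.
    by field; rewrite !rn0.
  rewrite [leLHS](_ : _ = rho ^- j * rho ^- j * rho ^- v *
      edot (qq (j + v)%N) (pp j)); last first.
    by rewrite (edotC (pp j)); field; rewrite !rn0.
  rewrite ler_pM2l ?mulr_gt0 //.
  by have := hj (j + v)%N j; rewrite edotBr; lra.
have tap_ge k (v : 'I_numax.+1) :
    rho ^+ v * lam v * g k + rho ^- v * lam v * delay hb v k <=
    lam v * edot (delay (fun j => rho ^- j *: pp j) v k) (rho ^- k *: qq k).
  have -> : rho ^+ v * lam v * g k + rho ^- v * lam v * delay hb v k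
    = lam v * (rho ^+ v * g k + rho ^- v * delay hb v k) by ring.
  have [v0|v1] := posnP v; last first.
    by have := tap_le k v v1; have := lam_neg v v1; nra.
  rewrite v0 /delay leq0n subn0 expr0 invr1 !mul1r /g subrK edotZl edotZr.
  by rewrite (edotC (pp k)) !mulrA.
apply: (@le_trans _ _ (\sum_(k < T) \sum_(v < numax.+1)
    (rho ^+ v * lam v * g k + rho ^- v * lam v * delay hb v k))); last first.
  by apply: ler_sum => k _; apply: ler_sum => v _; exact: tap_ge.
under eq_bigr do rewrite big_split /=.
rewrite big_split /= addr_ge0 //.
  apply: sumr_ge0 => k _; rewrite -mulr_suml mulr_ge0 //.
  apply: (le_trans (ltW lam_pos)); apply: ler_sum => v _.
  have [->|v1] := posnP v; first by rewrite expr0 invr1.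
  rewrite -subr_ge0 -mulrBl mulr_le0 ?lam_neg // subr_le0.
  apply: (@le_trans _ _ 1); first by rewrite exprn_ile1 // ltW.
  by rewrite invf_ge1 ?exprn_gt0 // exprn_ile1 // ltW.
rewrite exchange_big /=; set S := \sum_(k < T) hb k.
apply: (@le_trans _ _ (\sum_(v < numax.+1) rho ^- v * lam v * S)).
  by rewrite -mulr_suml mulr_ge0 ?(ltW lam_pos) // sumr_ge0.
apply: ler_sum => v _; rewrite -mulr_sumr.
have [->|v1] := posnP v.
  rewrite [X in _ <= _ * X](_ : _ = S) //.
  by apply: eq_bigr => k _; rewrite /delay leq0n subn0.
rewrite ler_wnM2l ?sum_delay_le //.
by rewrite mulr_ge0_le0 ?(ltW (rV0 _)) // lam_neg.
Qed.

Section Filter.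
Variables (R : realType) (n s c : nat) (G : lti R n (s * c) (s * c)).
Variables (m : 'I_s -> R) (L : 'I_s -> \bar R) (rho : R).
Variables (numax : nat) (lam : 'I_s -> 'I_numax.+1 -> R).

Local Notation Loop := (scaled_loop G m L rho).
Local Notation Fir := (fir_filter c lam).
Local Notation Fil := (filtered G m L rho lam).

(** The shift-register state of the filter when the recorded signal is [f]. *)
Definition register (f : nat -> 'cV[R]_(s * c)) (k : nat) :
    'cV[R]_(\sum_(j < numax) (s * c)) :=
  \mxcol_(j < numax) delay f j.+1 k.

Lemma register0 f : register f 0 = 0.
Proof.
rewrite -[RHS](mxcol0 (V := R) (p_ := fun _ : 'I_numax => (s * c)%N)).
by apply: eq_mxcol => j.
Qed.

Lemma fir_state f k :
  sA Fir *m register f k + sB Fir *m f k = register f k.+1.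
Proof.
rewrite /= /register mul_mxblock_mxrow mxcol_mul -mxcolD.
apply: eq_mxcol => i; rewrite delaySS.
case: i => -[|i] ilt /=.
  rewrite big1 ?add0r => [|j _]; last by rewrite raddf0 mul0mx.
  by rewrite mul1mx /delay leq0n subn0.
rewrite (bigD1 (Ordinal (ltnW ilt))) //= big1 => [|j ji].
  by rewrite eqxx mul1mx raddf0 mul0mx !addr0.
rewrite (_ : (i.+1 == j.+1) = false) ?raddf0 ?mul0mx //.
apply/negP => /eqP[ij]; case/negP: ji; apply/eqP/val_inj => /=; exact: esym.
Qed.

Lemma fir_output f k :
  sC Fir *m register f k + sD Fir *m f k =
  \sum_(v < numax.+1) tap c lam v *m delay f v k.
Proof.
rewrite /= /register mul_mxrow_mxcol big_ord_recl addrC; congr (_ + _).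
by rewrite /delay leq0n subn0.
Qed.

Lemma filtered_state x u f k : f k = sC Loop *m x + sD Loop *m u ->
  sA Fil *m col_mx x (register f k) + sB Fil *m u =
  col_mx (sA Loop *m x + sB Loop *m u) (register f k.+1).
Proof.
move=> fk; rewrite -fir_state fk.
have -> : sA Fil = block_mx (sA Loop) 0 (sB Fir *m sC Loop) (sA Fir) by [].
have -> : sB Fil = col_mx (sB Loop) (sB Fir *m sD Loop) by [].
rewrite mul_block_col mul_col_mx add_col_mx mul0mx addr0.
by rewrite (mulmxDr (sB Fir)) !mulmxA addrCA addrA.
Qed.

Lemma filtered_output x u f k : f k = sC Loop *m x + sD Loop *m u ->
  sC Fil *m col_mx x (register f k) + sD Fil *m u =
  \sum_(v < numax.+1) tap c lam v *m delay f v k.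
Proof.
move=> fk; rewrite -fir_output fk.
have -> : sC Fil = row_mx (sD Fir *m sC Loop) (sC Fir) by [].
have -> : sD Fil = sD Fir *m sD Loop by [].
by rewrite mul_row_col (mulmxDr (sD Fir)) !mulmxA addrCA addrA.
Qed.

End Filter.

(** * Interconnections and equilibria *)

(* Replaces the products [A *m v] by variables, after which an identity between
   column vectors can be checked entrywise by [ring]. *)
Ltac generalize_products v :=
  repeat match goal with |- context [@mulmx ?S ?a ?b ?d ?A v] =>
    generalize (@mulmx S a b d A v); intro end.

(** Any solution of the interconnection equations, in particular one found
    before eliminating the internal signals, is reproduced by the closed-loop
    matrices. *)
Lemma star_signals (R : realType) (n p q nu ny nk : nat)
    (P : network R n p q nu ny) (K : lti R nk ny nu)
    (x : 'cV[R]_n) (xi : 'cV[R]_nk) (w : 'cV[R]_p) (u : 'cV[R]_nu) (y : 'cV[R]_ny) :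
  star_wellposed P K ->
  y = nC2 P *m x + nD21 P *m w + nD2 P *m u ->
  u = sC K *m xi + sD K *m y ->
  sA (star P K) *m col_mx x xi + sB (star P K) *m w =
    col_mx (nA P *m x + nB1 P *m w + nB2 P *m u) (sA K *m xi + sB K *m y) /\
  sC (star P K) *m col_mx x xi + sD (star P K) *m w =
    nC1 P *m x + nD1 P *m w + nD12 P *m u.
Proof.
move=> wp yE uE; pose E := invmx (1%:M - nD2 P *m sD K).
have {}yE : y = E *m (nC2 P *m x + nD21 P *m w + nD2 P *m sC K *m xi).
  suff -> : nC2 P *m x + nD21 P *m w + nD2 P *m sC K *m xi
      = (1%:M - nD2 P *m sD K) *m y by rewrite mulKmx.
  rewrite mulmxBl mul1mx {1}yE uE mulmxDr !mulmxA.
  by rewrite addrA addrK.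
have {}uE : u = sC K *m xi +
    sD K *m E *m (nC2 P *m x + nD21 P *m w + nD2 P *m sC K *m xi).
  by rewrite uE {1}yE mulmxA.
split; rewrite /= -/E.
  rewrite mul_block_col mul_col_mx add_col_mx; congr col_mx.
    rewrite uE !(mulmxDl, mulmxDr, mulmxA).
    generalize_products x; generalize_products xi; generalize_products w.
    by apply/colP => i; rewrite !mxE; ring.
  rewrite yE !(mulmxDl, mulmxDr, mulmxA).
  generalize_products x; generalize_products xi; generalize_products w.
  by apply/colP => i; rewrite !mxE; ring.
rewrite mul_row_col uE !(mulmxDl, mulmxDr, mulmxA).
generalize_products x; generalize_products xi; generalize_products w.
by apply/colP => i; rewrite !mxE; ring.
Qed.

(** For a consensus value [b] and a balanced [w = N v], the regulator equation
    evaluated at [theta = (-b, v)] yields a steady state of the plant with output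
    [1 (x) b].  The internal model holds [eta = -theta] and already produces the
    required input, so the subcontroller stays at rest. *)
Lemma regulator_equilibrium (R : realType) (n s c nu ny nf : nat)
    (P : network R n (s * c) (s * c) nu ny) (N : 'M[R]_(s * c, s.-1 * c))
    (Pi : 'M[R]_(n, c + s.-1 * c)) (Gamma : 'M[R]_(nu, c + s.-1 * c))
    (Phi : 'M[R]_(ny, c + s.-1 * c)) (Sf : lti R nf ny ((c + s.-1 * c) + nu))
    (b : 'cV[R]_c) (v : 'cV[R]_(s.-1 * c)) :
  let G := star P (star (full_model Gamma Phi) Sf) in
  regulator_solution P N Pi Gamma Phi ->
  star_wellposed P (star (full_model Gamma Phi) Sf) ->
  exists x, x = sA G *m x + sB G *m (N *m v) /\
    ones_kron R s c *m b = sC G *m x + sD G *m (N *m v).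
Proof.
pose K := star (full_model Gamma Phi) Sf.
move=> G [regA regC regy] wp; rewrite {}/G -/K.
pose th := col_mx (- b) v.
have wpK : star_wellposed (full_model Gamma Phi) Sf.
  by rewrite /star_wellposed /= mul0mx subr0 unitmx1.
have [||KA KC] := @star_signals R _ _ _ _ _ _ (full_model Gamma Phi) Sf
    (- th) 0 (Phi *m th) 0 0 wpK.
- by rewrite /= mulmxN mul1mx mul0mx addr0 addNr.
- by rewrite !mulmx0 addr0.
have {}KA : sA K *m col_mx (- th) 0 + sB K *m (Phi *m th) = col_mx (- th) 0.
  by rewrite KA /= mul1mx !mul0mx !mulmx0 !addr0.
have {}KC : sC K *m col_mx (- th) 0 + sD K *m (Phi *m th) = Gamma *m th.
  by rewrite KC /= mulNmx mulmxN opprK !mul0mx mulmx0 !addr0.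
have rowE (a : nat) (M1 : 'M[R]_(a, c)) (M2 : 'M[R]_(a, s.-1 * c)) :
    row_mx M1 M2 *m th = - (M1 *m b) + M2 *m v.
  by rewrite mul_row_col mulmxN.
have [||GA GC] := @star_signals R _ _ _ _ _ _ P K
    (Pi *m th) (col_mx (- th) 0) (N *m v) (Gamma *m th) (Phi *m th) wp.
- by rewrite -regy !mulmxDl rowE mul0mx oppr0 add0r !mulmxA.
- by rewrite KC.
exists (col_mx (Pi *m th) (col_mx (- th) 0)); split.
  rewrite GA KA; congr col_mx.
  by rewrite -{1}regA !mulmxDl rowE mul0mx oppr0 add0r !mulmxA.
rewrite GC; apply/eqP; rewrite -subr_eq0 -oppr_eq0 opprB; apply/eqP.
have := congr1 (fun X => X *m th) regC.
rewrite mul0mx !mulmxDl rowE !mulmxA => <-.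
generalize_products th; generalize_products v.
by generalize_products b; apply/colP => i; rewrite !mxE; ring.
Qed.

(** * Exponential stability *)

Section Stability.
Variables (R : realType) (n s c : nat) (G : lti R n (s * c) (s * c)).
Variables (m : 'I_s -> R) (L : 'I_s -> \bar R) (rho : R).
Variables (numax : nat) (lam : 'I_s -> 'I_numax.+1 -> R).
Hypothesis mL : forall i, ((m i)%:E < L i)%E.
Hypothesis rho01 : 0 < rho < 1.
Hypothesis unitD : 1%:M - diag_kron c m *m sD G \in unitmx.
Hypothesis lam_pos : forall i, 0 < \sum_(v < numax.+1) rho ^- v * lam i v.
Hypothesis lam_neg : forall i (v : 'I_numax.+1), (1 <= v)%N -> lam i v <= 0.

Let mm := diag_kron c m.
Let sigma := diag_kron c (fun i => sector_width_inv (m i) (L i)).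
Let H := invmx (1%:M - mm *m sD G).

Local Notation Loop := (scaled_loop G m L rho).
Local Notation Fil := (filtered G m L rho lam).
Local Notation q := (shift_q m).
Local Notation p := (shift_p m L).

Lemma shift_qB (z w z' w' : 'cV[R]_(s * c)) : q (z - z') (w - w') = q z w - q z' w'.
Proof.
rewrite /shift_q -/mm mulmxBr; move: (mm *m z) (mm *m z') => a b.
by apply/colP => i; rewrite !mxE; ring.
Qed.

Lemma shift_pB (z w z' w' : 'cV[R]_(s * c)) : p (z - z') (w - w') = p z w - p z' w'.
Proof.
rewrite /shift_p shift_qB mulmxBr; move: (_ *m q z w) (_ *m q z' w') => a b.
by apply/colP => i; rewrite !mxE; ring.
Qed.

Lemma shift_qZ a (z w : 'cV[R]_(s * c)) : q (a *: z) (a *: w) = a *: q z w.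
Proof. by rewrite /shift_q -scalemxAr scalerBr. Qed.

Lemma shift_pZ a (z w : 'cV[R]_(s * c)) : p (a *: z) (a *: w) = a *: p z w.
Proof. by rewrite /shift_p shift_qZ -scalemxAr scalerBr. Qed.

(** The filtered plant is driven by the shifted signals: eliminating [w] between
    [z = C x + D w] and [q = w - mm z] gives the coefficients of the scaled
    loop. *)
Lemma scaled_loop_signals x w z : z = sC G *m x + sD G *m w ->
  [/\ w = H *m (q z w + mm *m (sC G *m x)),
      sA Loop *m x + sB Loop *m q z w = rho^-1 *: (sA G *m x + sB G *m w) &
      sC Loop *m x + sD Loop *m q z w = p z w].
Proof.
move=> zE; have wE : w = H *m (q z w + mm *m (sC G *m x)).
  have <- : z - sD G *m w = sC G *m x by rewrite zE addrK.
  exact: loop_w unitD z w.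
have pE : p z w = z - sigma *m q z w by [].
move: wE pE; set Q := q z w => wE ->; split=> //=; rewrite -/mm -/H.
  rewrite -!scalemxAl -scalerDr; congr (_ *: _).
  by rewrite wE mulmxDl !mulmxDr !mulmxA -addrA; congr (_ + _); exact: addrC.
have DwE : sD G *m w = sD G *m H *m Q + sD G *m H *m mm *m sC G *m x.
  by rewrite {1}wE !mulmxDr !mulmxA.
rewrite {1}zE DwE !mulmxDl mulNmx -/sigma addrA; congr (_ - _).
by rewrite -addrA; congr (_ + _); exact: addrC.
Qed.

(** The supplied energy is the sum over the blocks of the Zames-Falb
    expressions.  The potential of a block is its convex potential relative to
    the equilibrium: the tangent at the equilibrium is subtracted. *)
Lemma supply_ge0 F zs ws (z w : nat -> 'cV[R]_(s * c)) :
  classO m L F -> F zs ws -> (forall k, F (z k) (w k)) ->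
  let pb k := rho ^- k *: (p (z k) (w k) - p zs ws) in
  let qb k := rho ^- k *: (q (z k) (w k) - q zs ws) in
  forall T, 0 <= \sum_(k < T)
    edot (\sum_(v < numax.+1) tap c lam v *m delay pb v k) (qb k).
Proof.
move=> OF Fs Fk pb qb T; have [V hV] := classO_potential mL OF.
pose pp i k := blk i (p (z k) (w k) - p zs ws).
pose qq i k := blk i (q (z k) (w k) - q zs ws).
have delayE i v k :
    blk i (delay pb v k) = delay (fun j => rho ^- j *: pp i j) v k.
  rewrite /delay; case: ifP => _; first by rewrite /pb blkZ.
  by apply/colP => j; rewrite !mxE.
have -> : \sum_(k < T)
    edot (\sum_(v < numax.+1) tap c lam v *m delay pb v k) (qb k) =
  \sum_i \sum_(k < T) \sum_(v < numax.+1) lam i v *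
    edot (delay (fun j => rho ^- j *: pp i j) v k) (rho ^- k *: qq i k).
  rewrite [RHS]exchange_big /=; apply: eq_bigr => k _.
  rewrite edotC edot_sumr [RHS]exchange_big /=; apply: eq_bigr => v _.
  rewrite edotC edot_blk; apply: eq_bigr => i _.
  by rewrite blk_diag_kron edotZl delayE /qb blkZ.
apply: sumr_ge0 => i _.
pose h k := V i (z k) (w k) - V i zs ws - edot (blk i (q zs ws)) (pp i k).
apply: (zames_falb T (h := h) rho01 (lam_pos i) (@lam_neg i)) => [k|k j].
  have := hV i _ _ _ _ Fs (Fk k); have := hV i _ _ _ _ (Fk k) Fs.
  by rewrite /h /pp /qq !blkB !edotLR; lra.
have := hV i _ _ _ _ (Fk k) (Fk j).
by rewrite /h /pp /qq !blkB !edotLR; lra.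
Qed.

Lemma enorm_unscale (d : nat) (v x0 : 'cV[R]_d) (e : nat) (u0 : 'cV[R]_e) (a : R) k :
  0 <= a -> edot (rho ^- k *: v) (rho ^- k *: v) <= a * edot u0 u0 ->
  enorm v <= Num.sqrt a * rho ^+ k * enorm u0.
Proof.
have [r0 _] := andP rho01; move=> a0 h.
have rk : 0 < rho ^+ k by rewrite exprn_gt0.
apply: enorm_le; first by rewrite !mulr_ge0 ?sqrtr_ge0 ?enorm_ge0 // ltW.
rewrite !exprMn sqr_sqrtr // enorm_sqr mulrAC -ler_pdivrMr ?exprn_gt0 //.
apply: le_trans h; rewrite edotZl edotZr mulrA -invfM -expr2 mulrC.
by rewrite lexx.
Qed.

Lemma exponential_bound M : posdef M -> passivity_lmi Fil M ->
  exists2 gamma : R, 0 < gamma &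
    forall F, classO m L F -> forall xs ws zs,
    xs = sA G *m xs + sB G *m ws -> zs = sC G *m xs + sD G *m ws -> F zs ws ->
    forall x w z, trajectory F G x w z -> forall k,
    Num.max (enorm (x k - xs))
            (Num.max (enorm (w k - ws)) (enorm (z k - zs)))
      <= gamma * rho ^+ k * enorm (x 0%N - xs).
Proof.
have [r0 _] := andP rho01.
move=> Mp lmi; have [C C0 hC] := passivity_lmi_bounded Mp lmi.
have [KH KH0 hH] := mulmx_bounded H.
have [KM KM0 hM] := mulmx_bounded (mm *m sC G).
have [KC KC0 hKC] := mulmx_bounded (sC G).
have [KD KD0 hKD] := mulmx_bounded (sD G).
pose a := KH * (2 + 2 * KM); have a0 : 0 < a by rewrite mulr_gt0 ?addr_gt0 ?mulr_gt0.
pose a' := 2 * KC + 2 * (KD * a).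
have a'0 : 0 < a' by rewrite /a'; have := mulr_gt0 KD0 a0; lra.
pose g := C * (1 + a + a') + 1.
have g0 : 0 < g by rewrite ltr_wpDl // mulr_ge0 //; lra.
exists (Num.sqrt g) => [|F OF xs ws zs xsE zsE Fs x w z tr k].
  by rewrite sqrtr_gt0.
pose xb k := rho ^- k *: (x k - xs).
pose wb k := rho ^- k *: (w k - ws).
pose zb k := rho ^- k *: (z k - zs).
pose pb k := rho ^- k *: (p (z k) (w k) - p zs ws).
pose qb k := rho ^- k *: (q (z k) (w k) - q zs ws).
have qbE j : q (zb j) (wb j) = qb j by rewrite shift_qZ shift_qB.
have pbE j : p (zb j) (wb j) = pb j by rewrite shift_pZ shift_pB.
have zbE j : zb j = sC G *m xb j + sD G *m wb j.
  rewrite /zb /xb /wb -!scalemxAr -scalerDr; congr (_ *: _).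
  have [_ -> _] := tr j; rewrite {1}zsE !mulmxBr.
  move: (sC G *m x j) (sC G *m xs) (sD G *m w j) (sD G *m ws) => A1 A2 A3 A4.
  by apply/colP => i; rewrite !mxE; ring.
have sig j := scaled_loop_signals (zbE j).
have xbS j : xb j.+1 = sA Loop *m xb j + sB Loop *m qb j.
  have [_ + _] := sig j; rewrite qbE => ->.
  rewrite /xb /wb -!scalemxAr -scalerDr scalerA -invfM -exprS.
  congr (_ *: _); have [-> _ _] := tr j; rewrite {1}xsE !mulmxBr.
  move: (sA G *m x j) (sA G *m xs) (sB G *m w j) (sB G *m ws) => A1 A2 A3 A4.
  by apply/colP => i; rewrite !mxE; ring.
have pbF j : pb j = sC Loop *m xb j + sD Loop *m qb j.
  by have [_ _] := sig j; rewrite qbE pbE.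
pose X j := col_mx (xb j) (register numax pb j).
have XS j : X j.+1 = sA Fil *m X j + sB Fil *m qb j.
  by rewrite /X filtered_state // xbS.
have supply T : 0 <= \sum_(j < T) edot (sC Fil *m X j + sD Fil *m qb j) (qb j).
  have Fk j : F (z j) (w j) by have [] := tr j.
  have := supply_ge0 OF Fs Fk T; congr (_ <= _).
  by apply: eq_bigr => j _; rewrite /X filtered_output.
have := hC X qb XS supply k.
rewrite /X !edot_col_mx register0 edot0r addr0 {3 4}/xb expr0 invr1 !scale1r.
set E0 := edot (x 0%N - xs) _ => hk.
have E00 : 0 <= E0 by exact: edot_ge0.
have xk : edot (xb k) (xb k) <= C * E0.
  by have := edot_ge0 (register numax pb k); have := edot_ge0 (qb k); lra.
have qk : edot (qb k) (qb k) <= C * E0.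
  by have := edot_ge0 (register numax pb k); have := edot_ge0 (xb k); lra.
have wk : edot (wb k) (wb k) <= a * (C * E0).
  have [wE _ _] := sig k; rewrite wE qbE mulmxA.
  apply: (le_trans (hH _)); rewrite /a -mulrA ler_wpM2l //; first exact: ltW.
  apply: (le_trans (edot_triangle _ _)).
  have h2 := hM (xb k).
  have h3 : KM * edot (xb k) (xb k) <= KM * (C * E0) by rewrite ler_wpM2l // ltW.
  by lra.
have zk : edot (zb k) (zb k) <= a' * (C * E0).
  rewrite zbE; apply: (le_trans (edot_triangle _ _)).
  have h1 := hKC (xb k); have h2 := hKD (wb k).
  have h3 : KC * edot (xb k) (xb k) <= KC * (C * E0) by rewrite ler_wpM2l // ltW.
  have h4 : KD * edot (wb k) (wb k) <= KD * (a * (C * E0)).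
    by rewrite ler_wpM2l // ltW.
  by rewrite /a'; lra.
have CE0 : 0 <= C * E0 by rewrite mulr_ge0.
have aCE : 0 <= a * (C * E0) by rewrite mulr_ge0 // ltW.
have a'CE : 0 <= a' * (C * E0) by rewrite mulr_ge0 // ltW.
have gE : g * E0 = C * E0 + a * (C * E0) + a' * (C * E0) + E0 by rewrite /g; ring.
rewrite !ge_max; apply/and3P; split; apply: enorm_unscale => //; try exact: ltW;
  rewrite -/E0 gE.
- by rewrite -/(xb k); lra.
- by rewrite -/(wb k); lra.
- by rewrite -/(zb k); lra.
Qed.

(** With zero state the storage enters the dissipation inequality only through
    its nonnegative value one step later, so that the supply must be negative. *)
Lemma feedthrough_negdef M : posdef M -> passivity_lmi Fil M ->
  negdef (diag_kron c (lam^~ ord0) *m (sD G *m H - sigma)).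
Proof.
move=> Mp /passivity_lmi_dissipation [e e0 he] u u0.
have := he 0 u _ erefl; rewrite !mulmx0 !add0r !edot0l add0r subr0.
set y := sB Fil *m u => h.
have y0 : 0 <= edot y (M *m y).
  have [->|/Mp/ltW//] := eqVneq y 0; by rewrite edot0l.
have eu : 0 < e * edot u u by rewrite mulr_gt0 // edot_gt0.
move: h; rewrite [sD Fil]/= (edotC _ u) -/mm -/H -/sigma /tap => h; lra.
Qed.

Lemma lam0_gt0 i : 0 < lam i ord0.
Proof.
have [r0 _] := andP rho01.
apply: (lt_le_trans (lam_pos i)); rewrite big_ord_recl expr0 invr1 mul1r.
rewrite gerDl; apply: sumr_le0 => v _.
by rewrite mulr_ge0_le0 ?lam_neg // invr_ge0 exprn_ge0 // ltW.
Qed.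

End Stability.

Lemma enorm_geometric_cvg (R : realType) n (x : nat -> 'cV[R]_n) (a : 'cV[R]_n)
    (b rho : R) :
  0 < rho < 1 -> (forall k, enorm (x k - a) <= b * rho ^+ k) -> x @ \oo --> a.
Proof.
move=> /andP[r0 r1] h; apply/cvgrPdist_lt => e e0.
have := @cvg_geometric R b rho; rewrite gtr0_norm // => /(_ r1).
move=> /cvgrPdist_lt/(_ e e0); apply: filterS => k /=.
rewrite sub0r normrN => hk; rewrite distrC.
apply: le_lt_trans (norm_le_enorm _) (le_lt_trans (h k) (le_lt_trans _ hk)).
exact: ler_norm.
Qed.

Theorem proposition7p3
  (R : realType) (s c : nat) (hs : (1 <= s)%N) (hc : (1 <= c)%N)
  (n nu ny : nat)
  (P : network R n (s * c) (s * c) nu ny)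
  (N : 'M[R]_(s * c, s.-1 * c)) (hN : consensus_matrix N)
  (m : 'I_s -> R) (L : 'I_s -> \bar R)
  (hmL : forall i, ((m i)%:E < L i)%E) (hm : 0 < \sum_i m i)
  (Dspec : set 'M[R]_(s * c)) (Linfo LD : set 'M[R]_(nu, ny))
  (hinfo : information_set P Dspec Linfo)
  (h1 : assumption1 P m) (h2 : assumption2 P m) (h3 : assumption3 P)
  (h4 : assumption4 P N m) (h5 : assumption5 P Linfo LD)
  (Pi : 'M[R]_(n, c + s.-1 * c)) (Gamma : 'M[R]_(nu, c + s.-1 * c))
  (Phi : 'M[R]_(ny, c + s.-1 * c))
  (hreg : regulator_solution P N Pi Gamma Phi)
  (rho : R) (hrho : 0 < rho < 1) (numax nf : nat)
  (Sf : lti R nf ny ((c + s.-1 * c) + nu))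
  (lam : 'I_s -> 'I_numax.+1 -> R) :
  let K := star (full_model Gamma Phi) Sf in
  let G := star P K in
  star_wellposed P K ->
  LD (dsubmx (sD Sf)) ->
  1%:M - diag_kron c m *m sD G \in unitmx ->
  (exists M, [/\ M^T = M, posdef M &
                 passivity_lmi (filtered G m L rho lam) M]) ->
  (forall i, 0 < \sum_(v < numax.+1) rho ^- v * lam i v) ->
  (forall i (v : 'I_numax.+1), (1 <= v)%N -> lam i v <= 0) ->
  (forall F, classO m L F -> alg_wellposed F G) /\
  exp_convergent rho (classO m L) G.
Proof.
move=> K G wpP _ unitD [M [_ Mp lmi]] lam_pos lam_neg.
have lam0 i := lam0_gt0 hrho lam_pos lam_neg i.
have Dneg := feedthrough_negdef Mp lmi.
have [g g0 hg] := exponential_bound hmL hrho unitD lam_pos lam_neg Mp lmi.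
split=> [F OF|]; first exact: (classO_loop_continuous hmL OF unitD lam0 Dneg).
split=> [F OF|]; last first.
  exists g => // F OF xs ws zs [[xsE zsE Fs] _ _ _] x w z tr k.
  exact: (hg F OF).
have [b [ws [ws0 Fs]]] := classO_optimum OF.
have [v wsE] := (hN.2 ws).2 ws0; rewrite {}wsE in ws0 Fs.
have [xs [xsE zsE]] := regulator_equilibrium b v hreg wpP.
exists xs, (N *m v), (ones_kron R s c *m b); split=> //; first by exists b.
move=> x w z tr; have bnd := hg F OF _ _ _ xsE zsE Fs _ _ _ tr.
pose C := g * enorm (x 0%N - xs).
have bE k : g * rho ^+ k * enorm (x 0%N - xs) = C * rho ^+ k by rewrite mulrAC.
split; apply: (enorm_geometric_cvg (b := C) hrho) => k; rewrite -bE;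
  apply: le_trans (bnd k); rewrite !le_max lexx ?orbT //.
Qed.
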